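(* There are real numbers $a>0$ and $b>0$ such that the rotation number function $h\mapsto\rho_{b,a}(h)$ of $F_{b,a}$, associated to the closed ovals $\{(x,y)\in Q^+: V_{b,a}(x,y)=h\}$, has a local maximum.
   Context: $Q^+=\{(x,y)\in\mathbb{R}^2: x>0,\ y>0\}$. For $\alpha>0$, $F_\alpha:Q^+\to Q^+$ is $F_\alpha(x,y)=\left(y,\frac{\alpha+y}{x}\right)$, and for $a,b>0$ $$F_{b,a}(x,y)=F_b\circ F_a(x,y)=\left(\frac{a+y}{x},\frac{a+bx+y}{xy}\right).$$ The function $$V_{b,a}(x,y)=\frac{ax^2y+bxy^2+bx^2+ay^2+(b^2+a)x+(b+a^2)y+ab}{xy}$$ on $Q^+$ is a first integral of $F_{b,a}$, i.e. $V_{b,a}\circ F_{b,a}=V_{b,a}$. The map $F_{b,a}$ has a unique fixed point $\mathbf{p}\in Q^+$; set $h_c=V_{b,a}(\mathbf{p})$, the minimum value of $V_{b,a}$ on $Q^+$. For each $h>h_c$, the level set $\{V_{b,a}=h\}\subset Q^+$ is a simple closed curve (oval) surrounding $\mathbf{p}$, invariant under $F_{b,a}$, and the restriction of $F_{b,a}$ to it is conjugate to a rotation of the circle. The number $\rho_{b,a}(h)\in(0,1)$ denotes the rotation number of this restriction, where the oval is oriented counterclockwise: i.e. there is an orientation-preserving homeomorphism from the oval (oriented counterclockwise) to $\mathbb{R}/\mathbb{Z}$ that conjugates $F_{b,a}$ to $t\mapsto t+\rho_{b,a}(h)$. *)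

(* Defs.v *)
From Stdlib Require Import Reals.
From Coquelicot Require Import Coquelicot.
Open Scope R_scope.

Definition Qplus (q : R * R) : Prop := 0 < fst q /\ 0 < snd q.

Definition lyness (alpha : R) (q : R * R) : R * R :=
  (snd q, (alpha + snd q) / fst q).

Definition lyness2 (b a : R) (q : R * R) : R * R := lyness b (lyness a q).

Lemma lyness2_formula (b a x y : R) : 0 < x -> 0 < y ->
  lyness2 b a (x, y) = ((a + y) / x, (a + b * x + y) / (x * y)).
Proof.
  intros Hx Hy; unfold lyness2, lyness; simpl; f_equal; field.
  split; apply Rgt_not_eq; assumption.
Qed.

Definition V (b a : R) (q : R * R) : R :=
  let (x, y) := q in
  (a * x ^ 2 * y + b * x * y ^ 2 + b * x ^ 2 + a * y ^ 2
   + (b ^ 2 + a) * x + (b + a ^ 2) * y + a * b) / (x * y).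

Definition oval (b a h : R) (q : R * R) : Prop := Qplus q /\ V b a q = h.

(* A homeomorphism between R/Z and a planar set C is given by the 1-periodic
   map gamma : R -> C it induces, with gamma injective modulo Z and onto C.
   Continuity of the inverse C -> R/Z is automatic, since R/Z is compact. *)
Definition circle_parametrization (C : R * R -> Prop) (gamma : R -> R * R)
  : Prop :=
  (forall t : R, continuous gamma t) /\
  (forall s t : R, gamma s = gamma t <-> exists k : Z, s = t + IZR k) /\
  (forall q : R * R, C q <-> exists t : R, gamma t = q).

(* The 1-periodic curve gamma avoids p and has winding number +1 around it:
   2 * PI * theta is a continuous determination of the angle of gamma - p. For
   a simple closed curve, this says that the curve surrounds p and is
   traversed counterclockwise. *)
Definition counterclockwise (p : R * R) (gamma : R -> R * R) : Prop :=
  exists theta : R -> R,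
    (forall t : R, continuous theta t) /\
    (forall t : R, theta (t + 1) = theta t + 1) /\
    (forall t : R, exists d : R, 0 < d /\
       gamma t = (fst p + d * cos (2 * PI * theta t),
                  snd p + d * sin (2 * PI * theta t))).

(* The restriction of f to the closed curve C surrounding p, oriented
   counterclockwise, is conjugate to t |-> t + r on R/Z by an
   orientation-preserving homeomorphism. Such an r in (0,1) is unique. *)
Definition is_rotation_number (f : R * R -> R * R) (C : R * R -> Prop)
    (p : R * R) (r : R) : Prop :=
  0 < r < 1 /\
  exists gamma : R -> R * R,
    circle_parametrization C gamma /\
    counterclockwise p gamma /\
    (forall t : R, f (gamma t) = gamma (t + r)).

(* Strict: for a = b = 1 the map lyness2 is globally periodic and its rotation
   number function is constant, so non-strict maxima would be degenerate.
   [locally' h0] is the filter of punctured neighbourhoods of h0. *)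
Definition strict_local_max (f : R -> R) (h0 : R) : Prop :=
  locally' h0 (fun h : R => f h < f h0).

(* Main.v *)
Require Import Defs.
From Stdlib Require Import Reals Lra Lia ZArith List IndefiniteDescription.
From Coquelicot Require Import Coquelicot.
Import ListNotations.
Open Scope R_scope.

(* Write F = i2 o i1 with the involutions i1(x,y) = ((a+y)/x, y) and
   i2(x,y) = (x, (b+x)/y), which preserve V. In the coordinates (log x, log y)
   centred at the fixed point, V is a sum of exponentials with positive
   coefficients, so it increases along rays; its ovals are therefore polar graphs,
   and the Hamiltonian flow of V parametrizes each of them periodically. Both
   involutions reverse this flow, so F is a time shift along it, and rho is that
   shift divided by the period.

   To compare rho with 5/8, start the flow at the point q of the oval with
   i1 q = q lying to the right of the fixed point. Then i1 is t |-> -t, and the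
   side of the parabola x^2 = a + y on which a point of the oval lies tells whether
   its time is in the first or the second half of the period. The sides of F q and
   F^2 q give 1/2 < rho < 3/4, and the side of F^4 q is the sign of an explicit
   cubic polynomial in h, so that this sign is that of rho - 5/8. For suitable a, b
   the cubic is -c (h - h0)^2 (h - h1) with h1 below all the ovals: rho <= 5/8,
   with equality only at h0. *)

(** * Implicit functions and the flow on level curves of radial potentials *)

Lemma derive_pos_increasing (f df : R -> R) :
  (forall x, is_derive f x (df x)) -> (forall x, 0 < df x) ->
  forall x y, x < y -> f x < f y.
Proof.
  intros Hf Hp x y Hxy.
  apply (incr_function f m_infty p_infty df); try exact I; intros; auto; apply Hp.
Qed.

Lemma continuous_quotient (q d : R) : d <> 0 ->
  continuous (fun z : R * R => fst z / snd z) (q, d).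
Proof.
  intros Hd.
  apply (continuous_mult (K := R_AbsRing) (fun z : R * R => fst z) (fun z => / snd z)).
  - apply continuous_fst.
  - apply (continuous_comp (fun z : R * R => snd z) Rinv).
    + apply continuous_snd.
    + apply continuous_Rinv; exact Hd.
Qed.

Lemma continuous_pair_eps (g : R * R -> R) (x y : R) (eps : R) :
  continuous g (x, y) -> 0 < eps ->
  exists delta, 0 < delta /\ forall x' y', Rabs (x' - x) < delta ->
    Rabs (y' - y) < delta -> Rabs (g (x', y') - g (x, y)) < eps.
Proof.
  intros Hg He.
  destruct (Hg (ball (g (x, y)) eps)) as [delta Hd].
  { exists (mkposreal eps He); intros z Hz; exact Hz. }
  exists delta; split; [apply cond_pos |].
  intros x' y' Hx Hy; apply (Hd (x', y')); split; assumption.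
Qed.

(** Strict monotonicity of each [H x] traps [s x] between [s x0 - eps] and [s x0 + eps], which gives
    continuity of [s]. The mean value theorem in the second variable then writes the increment of
    [s] as [(h - H x (s x0)) / D x xi] with [xi] close to [s x0]. *)
Lemma implicit_function (H D : R -> R -> R) (s : R -> R) (h x0 dH : R) :
  (forall x r, is_derive (H x) r (D x r)) ->
  (forall x r, 0 < D x r) ->
  (forall r, continuous (fun x => H x r) x0) ->
  continuous (fun z : R * R => D (fst z) (snd z)) (x0, s x0) ->
  is_derive (fun x => H x (s x0)) x0 dH ->
  (forall x, H x (s x) = h) ->
  is_derive s x0 (- dH / D x0 (s x0)).
Proof.
  intros HD Dpos Hcont Dcont HdH Hs.
  assert (mono : forall x r r', r < r' -> H x r < H x r').
  { intros x; apply (derive_pos_increasing (H x) (D x)); auto. }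
  assert (scont : forall eps, 0 < eps ->
    locally x0 (fun x => Rabs (s x - s x0) < eps)).
  { intros eps He.
    assert (L1 : locally x0 (fun x => H x (s x0 - eps) < h)).
    { apply (Hcont (s x0 - eps) (fun y => y < h)).
      apply open_lt. rewrite <- (Hs x0); apply mono; lra. }
    assert (L2 : locally x0 (fun x => h < H x (s x0 + eps))).
    { apply (Hcont (s x0 + eps) (fun y => h < y)).
      apply open_gt. rewrite <- (Hs x0); apply mono; lra. }
    apply (filter_imp (fun x => H x (s x0 - eps) < h /\ h < H x (s x0 + eps)));
      [| apply filter_and; assumption].
    intros x [H1 H2]; apply Rabs_def1.
    - destruct (Rlt_or_le (s x) (s x0 + eps)) as [?|[Hl|He']]; [lra | |].
      + apply (mono x) in Hl; rewrite Hs in Hl; lra.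
      + rewrite He', Hs in H2; lra.
    - destruct (Rlt_or_le (s x0 - eps) (s x)) as [?|[Hl|He']]; [lra | |].
      + apply (mono x) in Hl; rewrite Hs in Hl; lra.
      + rewrite <- He', Hs in H1; lra. }
  apply is_derive_Reals; apply is_derive_Reals in HdH.
  intros eps He.
  assert (D0 := Dpos x0 (s x0)).
  destruct (continuous_pair_eps _ dH (D x0 (s x0)) eps
    (continuous_quotient _ _ (Rgt_not_eq _ _ D0)) He) as [d1 [d1p Hd1]].
  destruct (continuous_pair_eps _ x0 (s x0) d1 Dcont d1p) as [d2 [d2p Hd2]].
  destruct (HdH d1 d1p) as [d3 Hd3].
  destruct (scont d2 d2p) as [d4 Hd4].
  assert (dp : 0 < Rmin d2 (Rmin d3 d4)).
  { repeat apply Rmin_pos; try apply cond_pos; auto. }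
  exists (mkposreal _ dp); intros k k0 Hk; simpl in Hk.
  assert (Hk2 := Rlt_le_trans _ _ _ Hk (Rmin_l _ _)).
  assert (Hk34 := Rlt_le_trans _ _ _ Hk (Rmin_r _ _)).
  assert (Hk3 := Rlt_le_trans _ _ _ Hk34 (Rmin_l _ _)).
  assert (Hk4 := Rlt_le_trans _ _ _ Hk34 (Rmin_r _ _)).
  specialize (Hd3 k k0 Hk3).
  assert (Hs4 : Rabs (s (x0 + k) - s x0) < d2).
  { apply Hd4. change (Rabs ((x0 + k) - x0) < d4).
    replace (x0 + k - x0) with k by ring; exact Hk4. }
  destruct (MVT_gen (H (x0 + k)) (s x0) (s (x0 + k)) (D (x0 + k)))
    as [xi [Hxi Hmvt]].
  { intros; apply HD. }
  { intros x _. apply continuity_pt_filterlim.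
    apply (ex_derive_continuous (H (x0 + k))); eexists; apply HD. }
  assert (Hxi' : Rabs (xi - s x0) < d2).
  { apply Rle_lt_trans with (2 := Hs4). revert Hxi.
    unfold Rmin, Rmax, Rabs; repeat destruct Rle_dec; repeat destruct Rcase_abs; lra. }
  assert (Dxi := Dpos (x0 + k) xi).
  specialize (Hd2 (x0 + k) xi). simpl in Hd2.
  replace (x0 + k - x0) with k in Hd2 by ring.
  specialize (Hd2 Hk2 Hxi').
  specialize (Hd1 _ _ Hd3 Hd2). simpl in Hd1.
  rewrite Hs in Hmvt. rewrite (Hs x0) in Hd1.
  assert (Hm : s (x0 + k) - s x0 = (h - H (x0 + k) (s x0)) / D (x0 + k) xi).
  { rewrite Hmvt; field; lra. }
  rewrite Hm.
  rewrite Rabs_minus_sym in Hd1.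
  match goal with |- Rabs ?a < _ => match type of Hd1 with Rabs ?b < _ =>
    replace a with b; [exact Hd1|] end end.
  field; lra.
Qed.

Lemma is_derive_continuous (f : R -> R) (x l : R) : is_derive f x l -> continuous f x.
Proof. intros Hf; apply (ex_derive_continuous f); exists l; exact Hf. Qed.

Lemma derive_zero_constant (f : R -> R) :
  (forall x, is_derive f x 0) -> forall x y, f x = f y.
Proof.
  intros Hf.
  assert (lt : forall x y, x < y -> f x = f y).
  { intros x y Hxy; apply (eq_is_derive f x y); auto. }
  intros x y; destruct (Rtotal_order x y) as [H|[H|H]];
    [auto | subst; auto | symmetry; auto].
Qed.

Lemma shift_IZR (f : R -> R) (P Q : R) :
  (forall x, f (x + P) = f x + Q) ->
  forall (k : Z) x, f (x + IZR k * P) = f x + IZR k * Q.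
Proof.
  intros Hf k; induction k as [|k Hk|k Hk] using Z.peano_ind; intros x.
  - replace (x + 0 * P) with x by ring; ring.
  - rewrite succ_IZR; replace (x + (IZR k + 1) * P) with (x + IZR k * P + P) by ring.
    rewrite Hf, Hk; ring.
  - unfold Z.pred; rewrite plus_IZR.
    specialize (Hf (x + (IZR k + -1) * P)).
    replace (x + (IZR k + -1) * P + P) with (x + IZR k * P) in Hf by ring.
    rewrite Hk in Hf; lra.
Qed.

(** [T] will be the time as a function of the polar angle, and [T0] the period of the flow. *)
Lemma periodic_primitive (g : R -> R) (P : R) :
  0 < P -> (forall x, continuous g x) -> (forall x, 0 < g x) ->
  (forall x, g (x + P) = g x) ->
  exists (T : R -> R) (T0 : R), 0 < T0 /\ (forall x, is_derive T x (g x)) /\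
    (forall x, T (x + P) = T x + T0).
Proof.
  intros HP gcont gpos gper.
  set (T := fun x => RInt g 0 x).
  assert (dT : forall x, is_derive T x (g x)).
  { intros x; apply (is_derive_RInt g T 0 x); auto.
    apply filter_forall; intros y; apply (RInt_correct g).
    apply (ex_RInt_continuous g); auto. }
  assert (Tinc := derive_pos_increasing T g dT gpos).
  exists T, (T (0 + P) - T 0); split; [| split]; auto.
  - assert (T 0 < T (0 + P)) by (apply Tinc; lra); lra.
  - intros x.
    enough (Hc : T (x + P) - T x = T (0 + P) - T 0) by lra.
    apply (derive_zero_constant (fun y => T (y + P) - T y)); intros y.
    replace 0 with (1 * g (y + P) - g y) by (rewrite gper; ring).
    apply (is_derive_minus (fun y => T (y + P)) T); [| apply dT].
    apply (is_derive_comp T (fun y => y + P) y (g (y + P)) 1); [apply dT|].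
    auto_derive; auto.
Qed.

(** Turns time into angle: the shift rule makes [T] unbounded in both directions, hence onto, and
    its inverse is differentiable as the implicit solution of [T x - t = 0]. *)
Lemma primitive_inverse (T g : R -> R) (P T0 : R) :
  0 < P -> 0 < T0 -> (forall x, is_derive T x (g x)) -> (forall x, 0 < g x) ->
  (forall x, continuous g x) -> (forall x, T (x + P) = T x + T0) ->
  exists Phi : R -> R, (forall t, T (Phi t) = t) /\ (forall x, Phi (T x) = x) /\
    (forall t, is_derive Phi t (/ g (Phi t))) /\ (forall t, Phi (t + T0) = Phi t + P).
Proof.
  intros HP HT0 dT gpos gcont Tper.
  assert (Tinc := derive_pos_increasing T g dT gpos).
  assert (Tinj : forall x y, T x = T y -> x = y).
  { intros x y Hxy; destruct (Rtotal_order x y) as [H|[H|H]]; auto;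
      apply Tinc in H; lra. }
  assert (Hsurj : forall t, exists x, T x = t).
  { intros t.
    set (k := up (Rabs (t - T 0) / T0)).
    assert (Hk : Rabs (t - T 0) < IZR k * T0).
    { apply Rmult_lt_reg_r with (/ T0); [apply Rinv_0_lt_compat; auto|].
      rewrite Rmult_assoc, Rinv_r, Rmult_1_r by lra.
      apply (archimed (Rabs (t - T 0) / T0)). }
    assert (H1 := shift_IZR T P T0 Tper k 0).
    assert (H2 := shift_IZR T P T0 Tper (- k) 0).
    rewrite opp_IZR in H2.
    apply Rabs_def2 in Hk.
    destruct (IVT_gen T (0 + - IZR k * P) (0 + IZR k * P) t) as [x [_ Hx]].
    - intros x; apply continuity_pt_filterlim; apply (is_derive_continuous T _ _ (dT x)).
    - rewrite H1, H2, Rmin_left, Rmax_right; lra.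
    - exists x; exact Hx. }
  destruct (functional_choice (fun t x => T x = t) Hsurj) as [Phi HPhi].
  exists Phi; split; [| split; [| split]]; auto.
  - intros t.
    replace (/ g (Phi t)) with (- (-1) / g (Phi t)) by (field; apply Rgt_not_eq, gpos).
    apply (implicit_function (fun t x => T x - t) (fun _ x => g x) Phi 0 t (-1)); auto.
    + intros x r. auto_derive; [exists (g r); apply dT|].
      rewrite Rmult_1_l; apply is_derive_unique, dT.
    + intros r. apply (is_derive_continuous _ _ (-1)). auto_derive; auto.
    + apply (continuous_comp snd g); [apply continuous_snd | apply gcont].
    + auto_derive; auto.
    + intros x; rewrite HPhi; ring.
  - intros t; apply Tinj; rewrite Tper, !HPhi; reflexivity.
Qed.

Lemma cos_sin_inj (a b : R) : cos a = cos b -> sin a = sin b ->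
  exists k : Z, a = b + IZR k * (2 * PI).
Proof.
  intros Hc Hs.
  assert (H1 : cos (a - b) = 1).
  { rewrite cos_minus, Hc, Hs. generalize (sin2_cos2 b); unfold Rsqr; lra. }
  assert (H2 : sin ((a - b) / 2) = 0).
  { replace (a - b) with (2 * ((a - b) / 2)) in H1 by field.
    rewrite cos_2a_sin in H1. apply Rsqr_0_uniq; unfold Rsqr; lra. }
  destruct (sin_eq_0_0 _ H2) as [k Hk]; exists k; lra.
Qed.

Lemma polar_exists (u v : R) : u <> 0 \/ v <> 0 ->
  exists phi s, u = exp s * cos phi /\ v = exp s * sin phi.
Proof.
  intros Huv.
  assert (Hq : 0 < u ^ 2 + v ^ 2).
  { destruct Huv as [H|H]; apply pow2_gt_0 in H;
      generalize (pow2_ge_0 u) (pow2_ge_0 v); lra. }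
  set (q := sqrt (u ^ 2 + v ^ 2)).
  assert (qpos : 0 < q) by (apply sqrt_lt_R0; auto).
  assert (qq : q * q = u ^ 2 + v ^ 2) by (apply sqrt_sqrt; lra).
  assert (Hle : -1 <= u / q <= 1).
  { assert (Rabs u <= q).
    { unfold q; rewrite <- sqrt_Rsqr_abs; apply sqrt_le_1_alt; unfold Rsqr; nra. }
    assert (-q <= u <= q) by (apply Rabs_le_between; auto).
    split; apply Rmult_le_reg_r with q; auto; unfold Rdiv;
      rewrite Rmult_assoc, Rinv_l by lra; lra. }
  assert (Hsin : sin (acos (u / q)) = Rabs v / q).
  { rewrite sin_acos by auto.
    replace (1 - Rsqr (u / q)) with (Rsqr (v / q)).
    - rewrite sqrt_Rsqr_abs; unfold Rdiv; rewrite Rabs_mult, (Rabs_pos_eq (/ q)); auto.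
      left; apply Rinv_0_lt_compat; auto.
    - unfold Rsqr. apply Rmult_eq_reg_r with (q * q); [| nra].
      field_simplify; [| lra | lra]. simpl in *; lra. }
  exists (if Rle_dec 0 v then acos (u / q) else - acos (u / q)), (ln q).
  rewrite exp_ln by auto.
  destruct Rle_dec as [Hv|Hv].
  - rewrite cos_acos, Hsin, Rabs_pos_eq by auto. split; field; lra.
  - rewrite cos_neg, sin_neg, cos_acos, Hsin, Rabs_left by (auto; lra). split; field; lra.
Qed.

(** Conditions making every level above [E 0 0] a polar graph about the origin: [E] increases
    strictly along rays and is unbounded on each of them. Differentiability is stated as a chain
    rule along curves, the form in which it is applied. *)
Record radial_potential (E Eu Ev : R -> R -> R) : Prop := {
  rp_chain : forall (f g : R -> R) t f' g', is_derive f t f' -> is_derive g t g' ->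
    is_derive (fun s => E (f s) (g s)) t (Eu (f t) (g t) * f' + Ev (f t) (g t) * g');
  rp_cont_u : forall z, continuous (fun z : R * R => Eu (fst z) (snd z)) z;
  rp_cont_v : forall z, continuous (fun z : R * R => Ev (fst z) (snd z)) z;
  rp_radial : forall u v, u <> 0 \/ v <> 0 -> 0 < u * Eu u v + v * Ev u v;
  rp_coercive : exists K, 0 < K /\ forall u v, K * (Rabs u + Rabs v) <= E u v
}.

Lemma cos_sin_nonzero (s phi : R) : exp s * cos phi <> 0 \/ exp s * sin phi <> 0.
Proof.
  destruct (Req_dec (cos phi) 0) as [Hc|Hc].
  - right; intros H; apply Rmult_integral in H as [H|H].
    + apply (Rgt_not_eq (exp s) 0 (exp_pos s) H).
    + generalize (sin2_cos2 phi); unfold Rsqr; rewrite H, Hc; lra.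
  - left; intros H; apply Rmult_integral in H as [H|H]; auto.
    apply (Rgt_not_eq (exp s) 0 (exp_pos s) H).
Qed.

(** Intermediate value theorem on a ray. The radius is written [exp s], so that positivity is built
    in and the logarithmic radius ranges over the whole line. *)
Lemma radial_radius (E Eu Ev : R -> R -> R) (h : R) :
  radial_potential E Eu Ev -> E 0 0 < h ->
  forall phi, exists s, E (exp s * cos phi) (exp s * sin phi) = h.
Proof.
  intros HE Hh phi.
  set (f := fun r => E (r * cos phi) (r * sin phi)).
  assert (fcont : continuity f).
  { intros r; apply continuity_pt_filterlim.
    eapply is_derive_continuous; unfold f.
    apply (rp_chain _ _ _ HE (fun r => r * cos phi) (fun r => r * sin phi) r (cos phi) (sin phi));
      auto_derive; auto; ring. }
  destruct (rp_coercive _ _ _ HE) as [K [HK HKE]].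
  (* At this radius coercivity gives at least [Rabs h + 1] times [Rabs (cos phi) + Rabs (sin phi)],
     and the latter sum is at least 1. *)
  set (r1 := (Rabs h + 1) / K).
  assert (Hr1 : 0 < r1).
  { apply Rdiv_lt_0_compat; auto; generalize (Rabs_pos h); lra. }
  assert (Hf1 : h < f r1).
  { apply Rlt_le_trans with (2 := HKE _ _).
    rewrite !Rabs_mult, (Rabs_pos_eq r1) by lra.
    assert (1 <= Rabs (cos phi) + Rabs (sin phi)).
    { assert (Hc := sin2_cos2 phi); rewrite (Rsqr_abs (sin phi)), (Rsqr_abs (cos phi)) in Hc.
      unfold Rsqr in Hc; generalize (Rabs_pos (cos phi)) (Rabs_pos (sin phi)); nra. }
    assert (Hx : K * r1 = Rabs h + 1) by (unfold r1; field; lra).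
    replace (K * (r1 * Rabs (cos phi) + r1 * Rabs (sin phi)))
      with ((Rabs h + 1) * (Rabs (cos phi) + Rabs (sin phi))) by (rewrite <- Hx; ring).
    generalize (Rle_abs h) (Rabs_pos h); nra. }
  assert (Hf0 : f 0 < h) by (unfold f; rewrite !Rmult_0_l; auto).
  destruct (IVT_gen f 0 r1 h fcont) as [r [Hr Hfr]].
  { rewrite Rmin_left, Rmax_right; lra. }
  rewrite Rmin_left, Rmax_right in Hr by lra.
  assert (0 < r).
  { destruct Hr as [[Hr|Hr] _]; auto; subst; lra. }
  exists (ln r); rewrite exp_ln; auto.
Qed.

Lemma is_derive_polar (s f : R -> R) (t s' f' : R) :
  is_derive s t s' -> is_derive f t f' ->
  is_derive (fun t => exp (s t) * cos (f t)) t
    (exp (s t) * cos (f t) * s' - exp (s t) * sin (f t) * f') /\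
  is_derive (fun t => exp (s t) * sin (f t)) t
    (exp (s t) * sin (f t) * s' + exp (s t) * cos (f t) * f').
Proof.
  intros Hs Hf.
  assert (Es := is_derive_unique _ _ _ Hs). assert (Ef := is_derive_unique _ _ _ Hf).
  split; (auto_derive; [split; [exists s'; exact Hs | split; [exists f'; exact Hf | exact I]] |]);
    (replace (Derive (fun x => s x) t) with s' by auto);
    (replace (Derive (fun x => f x) t) with f' by auto); ring.
Qed.

(** On the level, the system [u' = - Ev], [v' = Eu] reduces to one equation for the polar angle,
    whose speed is [D / exp (2 * sig)] with [D] the derivative of [E] in the logarithmic radius.
    Integrating the inverse speed gives the time as a function of the angle; inverting it gives the
    angle at time [t], and [T0] is the time of one turn. *)
Lemma radial_flow (E Eu Ev : R -> R -> R) (h : R) :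
  radial_potential E Eu Ev -> E 0 0 < h ->
  exists (U W Phi sig : R -> R) (T0 : R), 0 < T0 /\
    (forall t, U t = exp (sig t) * cos (Phi t) /\ W t = exp (sig t) * sin (Phi t)) /\
    (forall t, is_derive U t (- Ev (U t) (W t)) /\ is_derive W t (Eu (U t) (W t))) /\
    (forall t, continuous Phi t /\ Phi (t + T0) = Phi t + 2 * PI) /\
    (forall u v, E u v = h <-> exists t, U t = u /\ W t = v) /\
    (forall s t, U s = U t /\ W s = W t <-> exists k : Z, s = t + IZR k * T0).
Proof.
  intros HE Hh.
  destruct (functional_choice _ (radial_radius E Eu Ev h HE Hh)) as [sig Hsig].
  set (u := fun phi s => exp s * cos phi). set (v := fun phi s => exp s * sin phi).
  (* [D] and [N] are the partial derivatives of [H] in the logarithmic radius and in the angle. *)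
  set (D := fun phi s => u phi s * Eu (u phi s) (v phi s) + v phi s * Ev (u phi s) (v phi s)).
  set (H := fun phi s => E (u phi s) (v phi s)).
  set (N := fun phi s => - v phi s * Eu (u phi s) (v phi s) + u phi s * Ev (u phi s) (v phi s)).
  assert (Dpos : forall phi s, 0 < D phi s).
  { intros; apply (rp_radial _ _ _ HE), cos_sin_nonzero. }
  assert (HD : forall phi s, is_derive (H phi) s (D phi s)).
  { intros phi s.
    replace (D phi s) with (Eu (u phi s) (v phi s) * u phi s + Ev (u phi s) (v phi s) * v phi s)
      by (unfold D; ring).
    apply (rp_chain _ _ _ HE (u phi) (v phi)); unfold u, v; auto_derive; auto; ring. }
  assert (HN : forall phi s, is_derive (fun x => H x s) phi (N phi s)).
  { intros phi s.
    replace (N phi s) with (Eu (u phi s) (v phi s) * - v phi s + Ev (u phi s) (v phi s) * u phi s)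
      by (unfold N; ring).
    apply (rp_chain _ _ _ HE (fun x => u x s) (fun x => v x s)); unfold u, v; auto_derive; auto; ring. }
  assert (ucont : forall z, continuous (fun z : R * R => u (fst z) (snd z)) z).
  { intros z. apply (continuous_mult (K := R_AbsRing) (fun z : R * R => exp (snd z)) (fun z : R * R => cos (fst z))).
    - apply (continuous_comp snd exp); [apply continuous_snd | apply continuous_exp].
    - apply (continuous_comp fst cos); [apply continuous_fst | apply continuous_cos]. }
  assert (vcont : forall z, continuous (fun z : R * R => v (fst z) (snd z)) z).
  { intros z. apply (continuous_mult (K := R_AbsRing) (fun z : R * R => exp (snd z)) (fun z : R * R => sin (fst z))).
    - apply (continuous_comp snd exp); [apply continuous_snd | apply continuous_exp].
    - apply (continuous_comp fst sin); [apply continuous_fst | apply continuous_sin]. }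
  assert (Dcont : forall z, continuous (fun z : R * R => D (fst z) (snd z)) z).
  { intros z.
    apply (continuous_plus (K := R_AbsRing) (V := R_NormedModule)
      (fun z : R * R => u (fst z) (snd z) * Eu (u (fst z) (snd z)) (v (fst z) (snd z)))
      (fun z : R * R => v (fst z) (snd z) * Ev (u (fst z) (snd z)) (v (fst z) (snd z))));
    apply (continuous_mult (K := R_AbsRing)); auto.
    - apply (continuous_comp_2 (fun z : R * R => u (fst z) (snd z)) (fun z => v (fst z) (snd z)) Eu);
        auto; apply (rp_cont_u _ _ _ HE).
    - apply (continuous_comp_2 (fun z : R * R => u (fst z) (snd z)) (fun z => v (fst z) (snd z)) Ev);
        auto; apply (rp_cont_v _ _ _ HE). }
  assert (dsig : forall phi, is_derive sig phi (- N phi (sig phi) / D phi (sig phi))).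
  { intros phi; apply (implicit_function H D sig h); auto.
    intros r; apply (is_derive_continuous _ _ _ (HN phi r)). }
  assert (Hinc : forall phi s s', H phi s = H phi s' -> s = s').
  { intros phi s s' Hss.
    destruct (Rtotal_order s s') as [Hl|[Hl|Hl]]; auto;
      apply (derive_pos_increasing (H phi) (D phi)) in Hl; auto; lra. }
  (* Both radii belong to the same ray and the same level, where the radius is unique. *)
  assert (sigper : forall phi, sig (phi + 2 * PI) = sig phi).
  { intros phi; apply (Hinc phi); unfold H at 2; unfold u, v. rewrite Hsig.
    rewrite <- (Hsig (phi + 2 * PI)); unfold H, u, v; f_equal; f_equal.
    - rewrite cos_plus, cos_2PI, sin_2PI; ring.
    - rewrite sin_plus, cos_2PI, sin_2PI; ring. }
  (* Time per unit of angle along the flow. *)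
  set (g := fun phi => exp (2 * sig phi) / D phi (sig phi)).
  assert (sigcont : forall phi, continuous sig phi).
  { intros phi; apply (is_derive_continuous _ _ _ (dsig phi)). }
  assert (gpos : forall x, 0 < g x).
  { intros x; apply Rdiv_lt_0_compat; auto; apply exp_pos. }
  assert (gcont : forall x, continuous g x).
  { intros x. apply (continuous_mult (K := R_AbsRing) (fun x => exp (2 * sig x)) (fun x => / D x (sig x))).
    - apply (continuous_comp (fun x => 2 * sig x) exp); [| apply continuous_exp].
      apply (continuous_mult (K := R_AbsRing) (fun _ => 2) sig); auto; apply continuous_const.
    - apply (continuous_comp (fun x => D x (sig x)) Rinv).
      + apply (continuous_comp_2 (fun x => x) sig D); auto; apply continuous_id.
      + apply continuous_Rinv, Rgt_not_eq, Dpos. }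
  assert (gper : forall x, g (x + 2 * PI) = g x).
  { intros x; unfold g, D, u, v; rewrite sigper, cos_plus, sin_plus, cos_2PI, sin_2PI.
    rewrite !Rmult_1_r, !Rmult_0_r, Rminus_0_r, Rplus_0_r; reflexivity. }
  assert (H2PI : 0 < 2 * PI) by (generalize PI_RGT_0; lra).
  destruct (periodic_primitive g (2 * PI) H2PI gcont gpos gper) as [T [T0 [HT0 [dT Tper]]]].
  destruct (primitive_inverse T g (2 * PI) T0 H2PI HT0 dT gpos gcont Tper)
    as [Phi [TPhi [PhiT [dPhi Phiper]]]].
  assert (dsP : forall t, is_derive (fun t => sig (Phi t)) t
    (- N (Phi t) (sig (Phi t)) / exp (2 * sig (Phi t)))).
  { intros t.
    replace (- N (Phi t) (sig (Phi t)) / exp (2 * sig (Phi t)))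
      with (/ g (Phi t) * (- N (Phi t) (sig (Phi t)) / D (Phi t) (sig (Phi t)))).
    - apply (is_derive_comp sig Phi); auto.
    - unfold g; field; split; apply Rgt_not_eq; solve [apply exp_pos | apply Dpos]. }
  exists (fun t => u (Phi t) (sig (Phi t))), (fun t => v (Phi t) (sig (Phi t))),
    Phi, (fun t => sig (Phi t)), T0.
  split; [exact HT0 |]; split; [intros t; split; reflexivity |].
  split; [| split; [| split]].
  - intros t.
    assert (He : exp (2 * sig (Phi t)) = exp (sig (Phi t)) * exp (sig (Phi t))).
    { rewrite <- exp_plus; f_equal; ring. }
    assert (H1 := sin2_cos2 (Phi t)); unfold Rsqr in H1.
    assert (Hep := exp_pos (sig (Phi t))).
    assert (dPhi' : is_derive Phi t (D (Phi t) (sig (Phi t)) / exp (2 * sig (Phi t)))).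
    { replace (D (Phi t) (sig (Phi t)) / exp (2 * sig (Phi t))) with (/ g (Phi t)); auto.
      unfold g; field; split; apply Rgt_not_eq; solve [apply exp_pos | apply Dpos]. }
    destruct (is_derive_polar _ _ _ _ _ (dsP t) dPhi') as [dU dV].
    split.
    + replace (- Ev _ _) with (u (Phi t) (sig (Phi t)) * (- N (Phi t) (sig (Phi t)) / exp (2 * sig (Phi t)))
        - v (Phi t) (sig (Phi t)) * (D (Phi t) (sig (Phi t)) / exp (2 * sig (Phi t)))); [exact dU|].
      unfold N, D; set (eu := Eu _ _); set (ev := Ev _ _); rewrite He; unfold u, v.
      field_simplify; [| lra].
      replace (sin (Phi t) ^ 2) with (1 - cos (Phi t) ^ 2) by lra; field; lra.
    + replace (Eu _ _) with (v (Phi t) (sig (Phi t)) * (- N (Phi t) (sig (Phi t)) / exp (2 * sig (Phi t)))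
        + u (Phi t) (sig (Phi t)) * (D (Phi t) (sig (Phi t)) / exp (2 * sig (Phi t)))); [exact dV|].
      unfold N, D; set (eu := Eu _ _); set (ev := Ev _ _); rewrite He; unfold u, v.
      field_simplify; [| lra].
      replace (sin (Phi t) ^ 2) with (1 - cos (Phi t) ^ 2) by lra; field; lra.
  - intros t; split; auto. apply (is_derive_continuous _ _ _ (dPhi t)).
  - intros u0 v0; split.
    + intros HE0.
      assert (Hnz : u0 <> 0 \/ v0 <> 0).
      { destruct (Req_dec u0 0) as [->|]; auto. destruct (Req_dec v0 0) as [->|]; auto; lra. }
      destruct (polar_exists u0 v0 Hnz) as [phi [s [Hu Hv]]].
      assert (Hs : sig phi = s).
      { apply (Hinc phi). unfold H, u, v. rewrite <- Hu, <- Hv, HE0; apply Hsig. }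
      exists (T phi). rewrite PhiT, Hs; auto.
    + intros [t [<- <-]]; apply Hsig.
  - intros s t; split.
    + unfold u, v; intros [Hu Hv].
      (* Summing squares shows that the two points have the same radius; cancelling it leaves equal
         cosines and equal sines. *)
      assert (Hsig2 : exp (sig (Phi s)) = exp (sig (Phi t))).
      { apply Rsqr_inj; try (left; apply exp_pos).
        generalize (sin2_cos2 (Phi s)) (sin2_cos2 (Phi t)); unfold Rsqr; intros H1 H2.
        assert (Hu2 := f_equal Rsqr Hu); assert (Hv2 := f_equal Rsqr Hv).
        rewrite !Rsqr_mult in Hu2, Hv2; unfold Rsqr in Hu2, Hv2; nra. }
      rewrite Hsig2 in Hu, Hv.
      apply Rmult_eq_reg_l in Hu; [| apply Rgt_not_eq, exp_pos].
      apply Rmult_eq_reg_l in Hv; [| apply Rgt_not_eq, exp_pos].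
      destruct (cos_sin_inj _ _ Hu Hv) as [k Hk]; exists k.
      rewrite <- (TPhi s), Hk, (shift_IZR T _ _ Tper), TPhi; reflexivity.
    + intros [k ->].
      assert (sigZ := shift_IZR sig (2 * PI) 0 (fun x => eq_trans (sigper x) (eq_sym (Rplus_0_r _)))).
      rewrite (shift_IZR Phi _ _ Phiper), sigZ, Rmult_0_r, Rplus_0_r.
      assert (Hcs : cos (Phi t + IZR k * (2 * PI)) = cos (Phi t) /\
                    sin (Phi t + IZR k * (2 * PI)) = sin (Phi t)).
      { rewrite (shift_IZR cos (2 * PI) 0), (shift_IZR sin (2 * PI) 0); [lra | |];
          intros x; rewrite ?cos_plus, ?sin_plus, cos_2PI, sin_2PI; ring. }
      unfold u, v; destruct Hcs as [-> ->]; auto.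
Qed.

(** * The Lyness potential in logarithmic coordinates *)

Fixpoint expsum (l : list (R * R * R)) (u v : R) : R :=
  match l with
  | [] => 0
  | (c, m, n) :: l' => c * exp (m * u + n * v) + expsum l' u v
  end.

Definition expsum_du (l : list (R * R * R)) : R -> R -> R :=
  expsum (map (fun z => let '(c, m, n) := z in (c * m, m, n)) l).

Definition expsum_dv (l : list (R * R * R)) : R -> R -> R :=
  expsum (map (fun z => let '(c, m, n) := z in (c * n, m, n)) l).

Lemma expsum_chain (l : list (R * R * R)) (f g : R -> R) (t f' g' : R) :
  is_derive f t f' -> is_derive g t g' ->
  is_derive (fun s => expsum l (f s) (g s)) t
    (expsum_du l (f t) (g t) * f' + expsum_dv l (f t) (g t) * g').
Proof.
  intros Hf Hg; induction l as [|[[c m] n] l IH]; unfold expsum_du, expsum_dv in *; simpl.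
  - replace (0 * f' + 0 * g') with 0 by ring; apply (is_derive_const 0 t).
  - match goal with |- is_derive _ _ ?d => replace d with
      (c * exp (m * f t + n * g t) * (m * f' + n * g') +
       (expsum (map (fun z => let '(c, m, n) := z in (c * m, m, n)) l) (f t) (g t) * f' +
        expsum (map (fun z => let '(c, m, n) := z in (c * n, m, n)) l) (f t) (g t) * g')) by ring end.
    apply (is_derive_plus (fun s => c * exp (m * f s + n * g s)) (fun s => expsum l (f s) (g s)));
      [| exact IH].
    auto_derive; [split; [exists f'; exact Hf | split; [exists g'; exact Hg | exact I]] |].
    replace (Derive (fun x => f x) t) with f' by (symmetry; apply is_derive_unique, Hf).
    replace (Derive (fun x => g x) t) with g' by (symmetry; apply is_derive_unique, Hg).
    ring.
Qed.

Lemma expsum_continuous (l : list (R * R * R)) (z : R * R) :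
  continuous (fun z : R * R => expsum l (fst z) (snd z)) z.
Proof.
  induction l as [|[[c m] n] l IH]; simpl; [apply continuous_const |].
  apply (continuous_plus (K := R_AbsRing) (V := R_NormedModule)
    (fun z : R * R => c * exp (m * fst z + n * snd z)) (fun z => expsum l (fst z) (snd z))); auto.
  apply (continuous_mult (K := R_AbsRing) (fun _ => c)); [apply continuous_const |].
  apply (continuous_comp (fun z : R * R => m * fst z + n * snd z) exp); [| apply continuous_exp].
  apply (continuous_plus (K := R_AbsRing) (V := R_NormedModule)
    (fun z : R * R => m * fst z) (fun z : R * R => n * snd z));
  apply (continuous_mult (K := R_AbsRing) (fun _ => _)); try apply continuous_const;
    [apply continuous_fst | apply continuous_snd].
Qed.

Lemma mult_expm1_pos (x : R) : x <> 0 -> 0 < x * (exp x - 1).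
Proof.
  intros Hx; assert (He := exp_ineq1 x Hx).
  destruct (Rdichotomy _ _ Hx) as [H|H]; [| nra].
  assert (exp x < 1) by (rewrite <- exp_0; apply exp_increasing; auto); nra.
Qed.

Lemma mult_expm1_nonneg (x : R) : 0 <= x * (exp x - 1).
Proof.
  destruct (Req_dec x 0) as [->|Hx]; [lra | left; apply mult_expm1_pos, Hx].
Qed.

(** With [w = m * u + n * v], each term contributes [c * (w * (exp w - 1))], where [w] and
    [exp w - 1] have the same sign. The subtracted gradient at the origin will vanish in the
    application, the origin being the fixed point. *)
Lemma expsum_radial_nonneg (l : list (R * R * R)) (u v : R) :
  List.Forall (fun z => 0 <= fst (fst z)) l ->
  0 <= u * (expsum_du l u v - expsum_du l 0 0) + v * (expsum_dv l u v - expsum_dv l 0 0).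
Proof.
  unfold expsum_du, expsum_dv.
  induction 1 as [|[[c m] n] l Hc Hl IH]; simpl; [lra |].
  simpl in Hc.
  rewrite !Rmult_0_r, Rplus_0_r, exp_0.
  generalize (Rmult_le_pos _ _ Hc (mult_expm1_nonneg (m * u + n * v))); intros H.
  match type of IH with 0 <= ?r => match type of H with 0 <= ?q =>
    apply Rle_trans with (q + r); [lra | right; ring] end end.
Qed.

Lemma exp_abs_bound (u : R) : Rabs u <= exp u + exp (- u).
Proof.
  generalize (exp_ineq1_le u) (exp_ineq1_le (- u)) (exp_pos u) (exp_pos (- u)).
  unfold Rabs; destruct Rcase_abs; lra.
Qed.

(** The Laurent monomials of [V], in the order [x], [y], [1/x], [1/y], [x/y], [y/x], [1/(x y)], at
    the point [(p1 * exp u, p2 * exp v)]. The first two are set apart later to obtain strict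
    inequalities. *)
Definition lyness_terms (a b p1 p2 : R) : list (R * R * R) :=
  [(a * p1, 1, 0); (b * p2, 0, 1); ((b + a ^ 2) / p1, -1, 0); ((b ^ 2 + a) / p2, 0, -1);
   (b * p1 / p2, 1, -1); (a * p2 / p1, -1, 1); (a * b / (p1 * p2), -1, -1)].

Lemma V_expsum (a b p1 p2 u v : R) : 0 < p1 -> 0 < p2 ->
  V b a (p1 * exp u, p2 * exp v) = expsum (lyness_terms a b p1 p2) u v.
Proof.
  intros H1 H2; unfold V, lyness_terms; simpl.
  replace (1 * u + 0 * v) with u by ring. replace (0 * u + 1 * v) with v by ring.
  replace (-1 * u + 0 * v) with (- u) by ring. replace (0 * u + -1 * v) with (- v) by ring.
  replace (1 * u + -1 * v) with (u + - v) by ring. replace (-1 * u + 1 * v) with (- u + v) by ring.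
  replace (-1 * u + -1 * v) with (- u + - v) by ring.
  rewrite !exp_plus, !exp_Ropp.
  generalize (exp_pos u) (exp_pos v); intros; field; repeat split; lra.
Qed.

(** This is [x] times the derivative of [V] in [x]; in factored form it visibly vanishes on the
    fixed curve of i1. The derivative in [v] factors likewise through the fixed curve of i2. *)
Lemma expsum_du_lyness (a b p1 p2 u v x y : R) : 0 < p1 -> 0 < p2 ->
  x = p1 * exp u -> y = p2 * exp v ->
  expsum_du (lyness_terms a b p1 p2) u v = (a + b / y) * (x - (y + a) / x).
Proof.
  intros H1 H2 -> ->; unfold expsum_du, lyness_terms; simpl.
  replace (1 * u + 0 * v) with u by ring. replace (0 * u + 1 * v) with v by ring.
  replace (-1 * u + 0 * v) with (- u) by ring. replace (0 * u + -1 * v) with (- v) by ring.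
  replace (1 * u + -1 * v) with (u + - v) by ring. replace (-1 * u + 1 * v) with (- u + v) by ring.
  replace (-1 * u + -1 * v) with (- u + - v) by ring.
  rewrite !exp_plus, !exp_Ropp.
  generalize (exp_pos u) (exp_pos v); intros; field; repeat split; lra.
Qed.

Lemma expsum_dv_lyness (a b p1 p2 u v x y : R) : 0 < p1 -> 0 < p2 ->
  x = p1 * exp u -> y = p2 * exp v ->
  expsum_dv (lyness_terms a b p1 p2) u v = (b + a / x) * (y - (x + b) / y).
Proof.
  intros H1 H2 -> ->; unfold expsum_dv, lyness_terms; simpl.
  replace (1 * u + 0 * v) with u by ring. replace (0 * u + 1 * v) with v by ring.
  replace (-1 * u + 0 * v) with (- u) by ring. replace (0 * u + -1 * v) with (- v) by ring.
  replace (1 * u + -1 * v) with (u + - v) by ring. replace (-1 * u + 1 * v) with (- u + v) by ring.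
  replace (-1 * u + -1 * v) with (- u + - v) by ring.
  rewrite !exp_plus, !exp_Ropp.
  generalize (exp_pos u) (exp_pos v); intros; field; repeat split; lra.
Qed.

(** The quadratic equations express that both involutions fix [(p1, p2)], which makes it a critical
    point of [V]. *)
Definition positive_fixed_point (a b p1 p2 : R) : Prop :=
  0 < a /\ 0 < b /\ 0 < p1 /\ 0 < p2 /\ p1 ^ 2 = a + p2 /\ p2 ^ 2 = b + p1.

(** The gradient vanishes at the origin, so the radial derivative is a sum of nonnegative terms,
    made positive by the monomials [x] and [y]. Coercivity comes from the monomials [x], [y], [1/x],
    [1/y] through [Rabs u <= exp u + exp (- u)]. *)
Lemma lyness_radial_potential (a b p1 p2 : R) :
  positive_fixed_point a b p1 p2 ->
  radial_potential (expsum (lyness_terms a b p1 p2))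
    (expsum_du (lyness_terms a b p1 p2)) (expsum_dv (lyness_terms a b p1 p2)).
Proof.
  intros [Ha [Hb [H1 [H2 [E1 E2]]]]].
  assert (c1 : 0 < a * p1) by nra. assert (c2 : 0 < b * p2) by nra.
  assert (c3 : 0 < (b + a ^ 2) / p1) by (apply Rdiv_lt_0_compat; nra).
  assert (c4 : 0 < (b ^ 2 + a) / p2) by (apply Rdiv_lt_0_compat; nra).
  assert (c5 : 0 < b * p1 / p2) by (apply Rdiv_lt_0_compat; nra).
  assert (c6 : 0 < a * p2 / p1) by (apply Rdiv_lt_0_compat; nra).
  assert (c7 : 0 < a * b / (p1 * p2)) by (apply Rdiv_lt_0_compat; nra).
  split.
  - intros; apply expsum_chain; assumption.
  - apply expsum_continuous.
  - apply expsum_continuous.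
  - intros u v Huv.
    assert (Z1 : expsum_du (lyness_terms a b p1 p2) 0 0 = 0).
    { rewrite (expsum_du_lyness a b p1 p2 0 0 p1 p2) by (auto; rewrite exp_0; ring).
      replace (p2 + a) with (p1 ^ 2) by lra; field; lra. }
    assert (Z2 : expsum_dv (lyness_terms a b p1 p2) 0 0 = 0).
    { rewrite (expsum_dv_lyness a b p1 p2 0 0 p1 p2) by (auto; rewrite exp_0; ring).
      replace (p1 + b) with (p2 ^ 2) by lra; field; lra. }
    assert (Hl : List.Forall (fun z => 0 <= fst (fst z)) (skipn 2 (lyness_terms a b p1 p2))).
    { repeat constructor; simpl; lra. }
    assert (H := expsum_radial_nonneg _ u v Hl).
    assert (H' : u * (expsum_du (lyness_terms a b p1 p2) u v - expsum_du (lyness_terms a b p1 p2) 0 0)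
      + v * (expsum_dv (lyness_terms a b p1 p2) u v - expsum_dv (lyness_terms a b p1 p2) 0 0)
      = a * p1 * (u * (exp u - 1)) + b * p2 * (v * (exp v - 1))
      + (u * (expsum_du (skipn 2 (lyness_terms a b p1 p2)) u v
              - expsum_du (skipn 2 (lyness_terms a b p1 p2)) 0 0)
       + v * (expsum_dv (skipn 2 (lyness_terms a b p1 p2)) u v
              - expsum_dv (skipn 2 (lyness_terms a b p1 p2)) 0 0))).
    { unfold expsum_du, expsum_dv; simpl.
      replace (1 * u + 0 * v) with u by ring. replace (0 * u + 1 * v) with v by ring.
      replace (1 * 0 + 0 * 0) with 0 by ring. replace (0 * 0 + 1 * 0) with 0 by ring.
      rewrite exp_0; ring. }
    rewrite Z1, Z2 in H'.
    assert (Hu := mult_expm1_nonneg u). assert (Hv := mult_expm1_nonneg v).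
    destruct Huv as [Hn|Hn]; apply mult_expm1_pos in Hn; nra.
  - set (K := Rmin (Rmin (a * p1) (b * p2)) (Rmin ((b + a ^ 2) / p1) ((b ^ 2 + a) / p2))).
    assert (HK : 0 < K) by (unfold K; repeat apply Rmin_pos; auto).
    assert (k1 : K <= a * p1) by (unfold K; eapply Rle_trans; apply Rmin_l).
    assert (k2 : K <= b * p2) by (unfold K; eapply Rle_trans; [apply Rmin_l | apply Rmin_r]).
    assert (k3 : K <= (b + a ^ 2) / p1) by (unfold K; eapply Rle_trans; [apply Rmin_r | apply Rmin_l]).
    assert (k4 : K <= (b ^ 2 + a) / p2) by (unfold K; eapply Rle_trans; apply Rmin_r).
    exists K; split; [exact HK |]; intros u v.
    unfold lyness_terms; simpl expsum.
    replace (1 * u + 0 * v) with u by ring. replace (0 * u + 1 * v) with v by ring.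
    replace (-1 * u + 0 * v) with (- u) by ring. replace (0 * u + -1 * v) with (- v) by ring.
    assert (t5 := Rmult_lt_0_compat _ _ c5 (exp_pos (1 * u + -1 * v))).
    assert (t6 := Rmult_lt_0_compat _ _ c6 (exp_pos (-1 * u + 1 * v))).
    assert (t7 := Rmult_lt_0_compat _ _ c7 (exp_pos (-1 * u + -1 * v))).
    assert (t1 := Rmult_le_compat_r _ _ _ (Rlt_le _ _ (exp_pos u)) k1).
    assert (t2 := Rmult_le_compat_r _ _ _ (Rlt_le _ _ (exp_pos v)) k2).
    assert (t3 := Rmult_le_compat_r _ _ _ (Rlt_le _ _ (exp_pos (- u))) k3).
    assert (t4 := Rmult_le_compat_r _ _ _ (Rlt_le _ _ (exp_pos (- v))) k4).
    assert (tu := Rmult_le_compat_l _ _ _ (Rlt_le _ _ HK) (exp_abs_bound u)).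
    assert (tv := Rmult_le_compat_l _ _ _ (Rlt_le _ _ HK) (exp_abs_bound v)).
    lra.
Qed.

(** [field_x] is [- x * y] times the derivative of [V] in [y], and [field_y] is [x * y] times its
    derivative in [x]: the Hamiltonian field of the logarithmic coordinates, read in the original
    ones. *)
Definition field_x (a b x y : R) : R := - (b * x + a) * (y - (x + b) / y).
Definition field_y (a b x y : R) : R := (a * y + b) * (x - (y + a) / x).

Definition trajectory (a b h : R) (X Y : R -> R) : Prop := forall t,
  oval b a h (X t, Y t) /\
  is_derive X t (field_x a b (X t) (Y t)) /\ is_derive Y t (field_y a b (X t) (Y t)).

(** Exponentiates the flow of the logarithmic potential. [Phi] remains the angle in logarithmic
    coordinates; [oval_counterclockwise] converts it into an angle of the original plane. *)
Lemma lyness_flow (a b p1 p2 h : R) :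
  positive_fixed_point a b p1 p2 -> V b a (p1, p2) < h ->
  exists (X Y Phi : R -> R) (T : R), 0 < T /\ trajectory a b h X Y /\
    (forall q, oval b a h q -> exists t, (X t, Y t) = q) /\
    (forall s t, (X s, Y s) = (X t, Y t) <-> exists k : Z, s = t + IZR k * T) /\
    (forall t, continuous Phi t /\ Phi (t + T) = Phi t + 2 * PI) /\
    (forall t, exists r, 0 < r /\
      X t = p1 * exp (r * cos (Phi t)) /\ Y t = p2 * exp (r * sin (Phi t))).
Proof.
  intros Hp Hh. assert (Hp' := Hp). destruct Hp' as [Ha [Hb [H1 [H2 _]]]].
  assert (Hh0 : expsum (lyness_terms a b p1 p2) 0 0 < h).
  { rewrite <- V_expsum, exp_0, !Rmult_1_r; auto. }
  destruct (radial_flow _ _ _ h (lyness_radial_potential _ _ _ _ Hp) Hh0)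
    as [U [W [Phi [sig [T [HT [HUW [Hd [HPhi [Hsurj Hinj]]]]]]]]]].
  exists (fun t => p1 * exp (U t)), (fun t => p2 * exp (W t)), Phi, T.
  split; [exact HT |]; split; [| split; [| split; [| split]]].
  - intros t; split; [| split].
    + split; [split; simpl; apply Rmult_lt_0_compat; auto; apply exp_pos |].
      rewrite V_expsum by auto; apply Hsurj; eauto.
    + destruct (Hd t) as [Hu _].
      replace (field_x _ _ _ _) with (p1 * (- expsum_dv (lyness_terms a b p1 p2) (U t) (W t) * exp (U t))).
      * auto_derive; [eexists; exact Hu |].
        replace (Derive (fun x => U x) t) with (- expsum_dv (lyness_terms a b p1 p2) (U t) (W t))
          by (symmetry; apply is_derive_unique, Hu). ring.
      * rewrite (expsum_dv_lyness a b p1 p2 (U t) (W t) (p1 * exp (U t)) (p2 * exp (W t))) by auto.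
        unfold field_x. generalize (exp_pos (U t)) (exp_pos (W t)); intros; field; lra.
    + destruct (Hd t) as [_ Hw].
      replace (field_y _ _ _ _) with (p2 * (expsum_du (lyness_terms a b p1 p2) (U t) (W t) * exp (W t))).
      * auto_derive; [eexists; exact Hw |].
        replace (Derive (fun x => W x) t) with (expsum_du (lyness_terms a b p1 p2) (U t) (W t))
          by (symmetry; apply is_derive_unique, Hw). ring.
      * rewrite (expsum_du_lyness a b p1 p2 (U t) (W t) (p1 * exp (U t)) (p2 * exp (W t))) by auto.
        unfold field_y. generalize (exp_pos (U t)) (exp_pos (W t)); intros; field; lra.
  - intros [x y] [[Hx Hy] HV]; simpl in Hx, Hy.
    assert (Ex : x = p1 * exp (ln (x / p1))) by (rewrite exp_ln; [field; lra | apply Rdiv_lt_0_compat; auto]).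
    assert (Ey : y = p2 * exp (ln (y / p2))) by (rewrite exp_ln; [field; lra | apply Rdiv_lt_0_compat; auto]).
    rewrite Ex, Ey, V_expsum in HV by auto.
    apply Hsurj in HV as [t [Hu Hw]]; exists t. rewrite Hu, Hw, <- Ex, <- Ey; reflexivity.
  - intros s t. rewrite <- Hinj; split.
    + intros He; injection He as Hx Hy.
      apply Rmult_eq_reg_l in Hx; [| lra]. apply Rmult_eq_reg_l in Hy; [| lra].
      apply exp_inv in Hx; apply exp_inv in Hy; auto.
    + intros [-> ->]; reflexivity.
  - exact HPhi.
  - intros t; exists (exp (sig t)); split; [apply exp_pos |].
    destruct (HUW t) as [-> ->]; auto.
Qed.

(** * Uniqueness of trajectories and the two involutions *)

(** [g t * exp (- K * t)] has a nonpositive derivative and starts from 0. *)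
Lemma gronwall_zero_right (g dg : R -> R) (K : R) :
  (forall t, is_derive g t (dg t)) -> (forall t, dg t <= K * g t) ->
  (forall t, 0 <= g t) -> g 0 = 0 -> forall t, 0 <= t -> g t = 0.
Proof.
  intros Hd Hle Hpos H0 t Ht.
  set (f := fun t => g t * exp (- K * t)).
  assert (Hf : forall s, is_derive f s ((dg s - K * g s) * exp (- K * s))).
  { intros s; unfold f; auto_derive; [exists (dg s); apply Hd |].
    replace (Derive (fun x => g x) s) with (dg s) by (symmetry; apply is_derive_unique, Hd).
    ring. }
  destruct (MVT_gen f 0 t (fun s => (dg s - K * g s) * exp (- K * s))) as [c [_ Hc]].
  { intros; apply Hf. }
  { intros s _; apply continuity_pt_filterlim, (is_derive_continuous f _ _ (Hf s)). }
  assert (H1 : f t <= 0).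
  { replace (f 0) with 0 in Hc by (unfold f; rewrite H0; ring).
    generalize (exp_pos (- K * c)) (Hle c); intros.
    assert ((dg c - K * g c) * exp (- K * c) <= 0) by nra. nra. }
  unfold f in H1; generalize (exp_pos (- K * t)) (Hpos t); nra.
Qed.

Lemma gronwall_zero (g dg : R -> R) (K : R) :
  (forall t, is_derive g t (dg t)) -> (forall t, Rabs (dg t) <= K * g t) ->
  (forall t, 0 <= g t) -> g 0 = 0 -> forall t, g t = 0.
Proof.
  intros Hd Hle Hpos H0 t; destruct (Rle_or_lt 0 t) as [Ht|Ht].
  - apply (gronwall_zero_right g dg K); auto.
    intros s; apply Rle_trans with (2 := Hle s), Rle_abs.
  - rewrite <- (Ropp_involutive t).
    apply (gronwall_zero_right (fun s => g (- s)) (fun s => - dg (- s)) K); [| | | | lra].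
    + intros s; auto_derive; [exists (dg (- s)); apply Hd |].
      replace (Derive (fun x => g x) (- s)) with (dg (- s))
        by (symmetry; apply is_derive_unique, Hd). ring.
    + intros s; generalize (Hle (- s)); unfold Rabs; destruct Rcase_abs; lra.
    + auto.
    + rewrite Ropp_0; auto.
Qed.

Lemma field_x_lipschitz (a b M x y x' y' : R) :
  0 < a -> 0 < b -> 0 < x <= M -> 0 < x' <= M -> 0 < y <= M -> 0 < y' <= M ->
  / y <= M -> / y' <= M ->
  Rabs (field_x a b x y - field_x a b x' y') <=
    (2 * b * M + a + b * (M + M) * M + (b ^ 2 + a) * M +
     M * M * (b * M ^ 2 + (b ^ 2 + a) * M + a * b)) * (Rabs (x - x') + Rabs (y - y')).
Proof.
  intros Ha Hb Hx Hx' Hy Hy' Hi Hi'.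
  (* [A1] and [A2] are the divided differences of [field_x], first in [x] at fixed [y], then in [y]
     at fixed [x']. *)
  set (A1 := - (b * y) + b * (x + x') * / y + (b ^ 2 + a) * / y).
  set (A2 := - (b * x' + a) - / y * / y' * (b * x' ^ 2 + (b ^ 2 + a) * x' + a * b)).
  replace (field_x a b x y - field_x a b x' y') with (A1 * (x - x') + A2 * (y - y')).
  2:{ unfold A1, A2, field_x; field; lra. }
  assert (pi : 0 < / y) by (apply Rinv_0_lt_compat; lra).
  assert (pi' : 0 < / y') by (apply Rinv_0_lt_compat; lra).
  set (L := 2 * b * M + _ + _ + _ + _).
  assert (B1 : b * y <= b * M) by (apply Rmult_le_compat_l; lra).
  assert (B2 : b * (x + x') * / y <= b * (M + M) * M).
  { apply Rmult_le_compat; try lra; [apply Rmult_le_pos; lra | apply Rmult_le_compat_l; lra]. }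
  assert (B3 : (b ^ 2 + a) * / y <= (b ^ 2 + a) * M) by (apply Rmult_le_compat_l; nra).
  assert (B4 : b * x' <= b * M) by (apply Rmult_le_compat_l; lra).
  assert (B5 : / y * / y' <= M * M) by (apply Rmult_le_compat; lra).
  assert (B6 : b * x' ^ 2 + (b ^ 2 + a) * x' + a * b <= b * M ^ 2 + (b ^ 2 + a) * M + a * b).
  { assert (x' ^ 2 <= M ^ 2) by (apply pow_incr; lra).
    assert ((b ^ 2 + a) * x' <= (b ^ 2 + a) * M) by (apply Rmult_le_compat_l; nra). nra. }
  assert (P6 : 0 < b * x' ^ 2 + (b ^ 2 + a) * x' + a * b).
  { assert (0 < b * x' ^ 2) by (apply Rmult_lt_0_compat; [lra | apply pow_lt; lra]).
    assert (0 < (b ^ 2 + a) * x') by (apply Rmult_lt_0_compat; nra). nra. }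
  assert (B7 : / y * / y' * (b * x' ^ 2 + (b ^ 2 + a) * x' + a * b) <=
    M * M * (b * M ^ 2 + (b ^ 2 + a) * M + a * b)).
  { apply Rmult_le_compat; try lra. apply Rmult_le_pos; lra. }
  assert (P2 : 0 <= b * (x + x') * / y) by (repeat apply Rmult_le_pos; lra).
  assert (P3 : 0 <= (b ^ 2 + a) * / y) by (apply Rmult_le_pos; nra).
  assert (P1 : 0 <= b * y) by nra. assert (P4 : 0 <= b * x') by nra.
  assert (P7 : 0 <= / y * / y' * (b * x' ^ 2 + (b ^ 2 + a) * x' + a * b)).
  { repeat apply Rmult_le_pos; lra. }
  assert (H1 : Rabs A1 <= L) by (apply Rabs_le; unfold A1, L; lra).
  assert (H2 : Rabs A2 <= L) by (apply Rabs_le; unfold A2, L; lra).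
  apply Rle_trans with (1 := Rabs_triang _ _); rewrite !Rabs_mult.
  generalize (Rabs_pos (x - x')) (Rabs_pos (y - y')); nra.
Qed.

(** Exchanging the coordinates together with the parameters reverses the field, so estimates for
    [field_x] carry over to [field_y]. *)
Lemma field_y_swap (a b x y : R) : field_y a b x y = - field_x b a y x.
Proof. unfold field_x, field_y; ring. Qed.

(** [V] is a sum of positive monomials, so each of them is at most [h]. The bounds on the inverses
    keep the oval away from the axes, where the field is singular. *)
Lemma oval_bounds (a b h : R) : 0 < a -> 0 < b -> exists M, forall x y,
  oval b a h (x, y) -> (0 < x <= M /\ / x <= M) /\ (0 < y <= M /\ / y <= M).
Proof.
  intros Ha Hb; exists (h / a + h / b + h / (b + a ^ 2) + h / (b ^ 2 + a)).
  intros x y [[Hx Hy] HV]; simpl in Hx, Hy.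
  assert (ca : 0 < b + a ^ 2) by nra. assert (cb : 0 < b ^ 2 + a) by nra.
  assert (E : h = a * x + b * y + (b + a ^ 2) * / x + (b ^ 2 + a) * / y +
    (b * x * / y + a * y * / x + a * b * / x * / y)) by (rewrite <- HV; unfold V; field; lra).
  assert (ix := Rinv_0_lt_compat x Hx). assert (iy := Rinv_0_lt_compat y Hy).
  assert (0 < b * x * / y + a * y * / x + a * b * / x * / y).
  { repeat apply Rplus_lt_0_compat; repeat apply Rmult_lt_0_compat; auto. }
  assert (t1 : 0 < a * x) by nra. assert (t2 : 0 < b * y) by nra.
  assert (t3 : 0 < (b + a ^ 2) * / x) by nra. assert (t4 : 0 < (b ^ 2 + a) * / y) by nra.
  assert (bound : forall c z, 0 < c -> 0 < c * z -> c * z <= h -> 0 < z <= h / c).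
  { intros c z Hc Hz Hcz; split; [nra |].
    apply Rmult_le_reg_l with c; auto; replace (c * (h / c)) with h by (field; lra); auto. }
  assert (b1 := bound _ _ Ha t1 ltac:(lra)). assert (b2 := bound _ _ Hb t2 ltac:(lra)).
  assert (b3 := bound _ _ ca t3 ltac:(lra)). assert (b4 := bound _ _ cb t4 ltac:(lra)).
  lra.
Qed.

(** Both trajectories stay in a region where the field is Lipschitz, so the Gronwall argument
    applies to their squared distance. *)
Lemma trajectory_unique (a b h : R) (X Y X' Y' : R -> R) :
  0 < a -> 0 < b -> trajectory a b h X Y -> trajectory a b h X' Y' ->
  X 0 = X' 0 -> Y 0 = Y' 0 -> forall t, X t = X' t /\ Y t = Y' t.
Proof.
  intros Ha Hb H H' EX EY.
  destruct (oval_bounds a b h Ha Hb) as [M HM].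
  set (L := fun a b => 2 * b * M + a + b * (M + M) * M + (b ^ 2 + a) * M +
     M * M * (b * M ^ 2 + (b ^ 2 + a) * M + a * b)).
  set (g := fun t => (X t - X' t) ^ 2 + (Y t - Y' t) ^ 2).
  set (DX := fun t => field_x a b (X t) (Y t) - field_x a b (X' t) (Y' t)).
  set (DY := fun t => field_y a b (X t) (Y t) - field_y a b (X' t) (Y' t)).
  assert (Mpos : 0 < M) by (destruct (HM _ _ (proj1 (H 0))); lra).
  assert (Lpos : forall a b, 0 < a -> 0 < b -> 0 <= L a b).
  { intros a0 b0 Ha0 Hb0; unfold L.
    repeat apply Rplus_le_le_0_compat; repeat apply Rmult_le_pos; try lra; try nra. }
  assert (g0 : forall t, g t = 0).
  { apply (gronwall_zero g (fun t => 2 * (X t - X' t) * DX t + 2 * (Y t - Y' t) * DY t)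
      (4 * (L a b + L b a))).
    - intros t; destruct (H t) as [_ [dX dY]], (H' t) as [_ [dX' dY']].
      unfold g; auto_derive; [repeat split; eexists; eassumption |].
      replace (Derive (fun x => X x) t) with (field_x a b (X t) (Y t)) by (symmetry; apply is_derive_unique, dX).
      replace (Derive (fun x => Y x) t) with (field_y a b (X t) (Y t)) by (symmetry; apply is_derive_unique, dY).
      replace (Derive (fun x => X' x) t) with (field_x a b (X' t) (Y' t)) by (symmetry; apply is_derive_unique, dX').
      replace (Derive (fun x => Y' x) t) with (field_y a b (X' t) (Y' t)) by (symmetry; apply is_derive_unique, dY').
      unfold DX, DY; ring.
    - intros t; destruct (HM _ _ (proj1 (H t))) as [[B1 B2] [B3 B4]].
      destruct (HM _ _ (proj1 (H' t))) as [[B1' B2'] [B3' B4']].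
      assert (HX := field_x_lipschitz a b M _ _ _ _ Ha Hb B1 B1' B3 B3' B4 B4').
      assert (HY := field_x_lipschitz b a M _ _ _ _ Hb Ha B3 B3' B1 B1' B2 B2').
      fold (L a b) in HX; fold (L b a) in HY; fold (DX t) in HX.
      assert (EDY : Rabs (DY t) = Rabs (field_x b a (Y t) (X t) - field_x b a (Y' t) (X' t))).
      { unfold DY; rewrite !field_y_swap, <- Rabs_Ropp; f_equal; ring. }
      rewrite <- EDY in HY.
      apply Rle_trans with (1 := Rabs_triang _ _); rewrite !Rabs_mult, (Rabs_pos_eq 2) by lra.
      unfold g; rewrite <- (pow2_abs (X t - X' t)), <- (pow2_abs (Y t - Y' t)).
      revert HX HY; generalize (Lpos a b Ha Hb) (Lpos b a Hb Ha).
      generalize (Rabs_pos (X t - X' t)) (Rabs_pos (Y t - Y' t)).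
      generalize (Rabs (X t - X' t)) (Rabs (Y t - Y' t)) (Rabs (DX t)) (Rabs (DY t)) (L a b) (L b a).
      intros dx dy fx fy l l' pdx pdy pl pl' HX HY.
      assert (dx * fx <= dx * (l * (dx + dy))) by (apply Rmult_le_compat_l; auto).
      assert (dy * fy <= dy * (l' * (dy + dx))) by (apply Rmult_le_compat_l; auto).
      assert (2 * (dx * dy) <= dx ^ 2 + dy ^ 2) by (generalize (pow2_ge_0 (dx - dy)); nra).
      assert (l * (2 * (dx * dy)) <= l * (dx ^ 2 + dy ^ 2)) by (apply Rmult_le_compat_l; auto).
      assert (l' * (2 * (dx * dy)) <= l' * (dx ^ 2 + dy ^ 2)) by (apply Rmult_le_compat_l; auto).
      assert (0 <= l * dx ^ 2) by (apply Rmult_le_pos; auto; apply pow2_ge_0).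
      assert (0 <= l * dy ^ 2) by (apply Rmult_le_pos; auto; apply pow2_ge_0).
      assert (0 <= l' * dx ^ 2) by (apply Rmult_le_pos; auto; apply pow2_ge_0).
      assert (0 <= l' * dy ^ 2) by (apply Rmult_le_pos; auto; apply pow2_ge_0).
      lra.
    - intros t; unfold g; generalize (pow2_ge_0 (X t - X' t)) (pow2_ge_0 (Y t - Y' t)); lra.
    - unfold g; rewrite EX, EY; ring. }
  intros t; specialize (g0 t); unfold g in g0.
  generalize (pow2_ge_0 (X t - X' t)) (pow2_ge_0 (Y t - Y' t)); intros q1 q2.
  split; apply Rminus_diag_uniq, Rsqr_0_uniq; unfold Rsqr; lra.
Qed.

Lemma trajectory_shift (a b h s : R) (X Y : R -> R) :
  trajectory a b h X Y -> trajectory a b h (fun t => X (t + s)) (fun t => Y (t + s)).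
Proof.
  intros H t; destruct (H (t + s)) as [Ho [dX dY]]; split; [exact Ho |].
  split; (rewrite <- (Rmult_1_l (field_x _ _ _ _)) || rewrite <- (Rmult_1_l (field_y _ _ _ _))).
  - apply (is_derive_comp X (fun t => t + s)); [exact dX | auto_derive; auto].
  - apply (is_derive_comp Y (fun t => t + s)); [exact dY | auto_derive; auto].
Qed.

(** The involution i1 preserves [V] and sends the field to its opposite, which time reversal
    compensates. *)
Lemma trajectory_iota_x (a b h : R) (X Y : R -> R) : 0 < a ->
  trajectory a b h X Y ->
  trajectory a b h (fun t => (a + Y (- t)) / X (- t)) (fun t => Y (- t)).
Proof.
  intros Ha H t; destruct (H (- t)) as [[[Hx Hy] HV] [dX dY]]; simpl in Hx, Hy.
  split; [| split].
  - split; [split; simpl; auto; apply Rdiv_lt_0_compat; lra |].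
    rewrite <- HV; unfold V; field; lra.
  - auto_derive; [repeat split; try (eexists; eassumption); lra |].
    replace (Derive (fun x => X x) (- t)) with (field_x a b (X (- t)) (Y (- t))) by (symmetry; apply is_derive_unique, dX).
    replace (Derive (fun x => Y x) (- t)) with (field_y a b (X (- t)) (Y (- t))) by (symmetry; apply is_derive_unique, dY).
    unfold field_x, field_y; field; lra.
  - auto_derive; [eexists; eassumption |].
    replace (Derive (fun x => Y x) (- t)) with (field_y a b (X (- t)) (Y (- t))) by (symmetry; apply is_derive_unique, dY).
    unfold field_y; field; lra.
Qed.

Lemma trajectory_iota_y (a b h : R) (X Y : R -> R) : 0 < b ->
  trajectory a b h X Y ->
  trajectory a b h (fun t => X (- t)) (fun t => (b + X (- t)) / Y (- t)).
Proof.
  intros Hb H t; destruct (H (- t)) as [[[Hx Hy] HV] [dX dY]]; simpl in Hx, Hy.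
  split; [| split].
  - split; [split; simpl; auto; apply Rdiv_lt_0_compat; lra |].
    rewrite <- HV; unfold V; field; lra.
  - auto_derive; [eexists; eassumption |].
    replace (Derive (fun x => X x) (- t)) with (field_x a b (X (- t)) (Y (- t))) by (symmetry; apply is_derive_unique, dX).
    unfold field_x; field; lra.
  - auto_derive; [repeat split; try (eexists; eassumption); lra |].
    replace (Derive (fun x => X x) (- t)) with (field_x a b (X (- t)) (Y (- t))) by (symmetry; apply is_derive_unique, dX).
    replace (Derive (fun x => Y x) (- t)) with (field_y a b (X (- t)) (Y (- t))) by (symmetry; apply is_derive_unique, dY).
    unfold field_x, field_y; field; lra.
Qed.

(** On the parabola, [y ^ 2 - x - b] factors as [(x - p1) * ((x + p1) * (y + p2) - 1)], and both
    coordinates of the fixed point exceed 1. The second inequality means that i2 lowers the point;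
    it decides the direction of the flow there. *)
Lemma right_of_fixed_point (a b p1 p2 x y : R) :
  positive_fixed_point a b p1 p2 -> p1 < x -> x ^ 2 = a + y ->
  p2 < y /\ x + b < y ^ 2.
Proof.
  intros [Ha [Hb [H1 [H2 [E1 E2]]]]] Hx Ey.
  assert (Hy : p2 < y) by nra.
  (* Otherwise [p2 < p1 ^ 2 <= p1 <= 1], hence [p1 < p2 ^ 2 < p2 * p1 < p1]. *)
  assert (G1 : 1 < p1).
  { apply Rnot_le_lt; intros Hle.
    assert (p2 < p1 ^ 2) by lra. assert (p1 ^ 2 <= p1) by nra.
    assert (p2 ^ 2 < p2 * p1) by nra. nra. }
  assert (G2 : 1 < p2) by nra.
  split; auto.
  assert (E : y ^ 2 - x - b = (x - p1) * ((x + p1) * (y + p2) - 1)).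
  { replace y with (p2 + (x ^ 2 - p1 ^ 2)) by lra.
    replace b with (p2 ^ 2 - p1) by lra. ring. }
  assert (1 < (x + p1) * (y + p2)) by nra.
  nra.
Qed.

(** As i1 fixes the starting point, uniqueness of trajectories identifies i1 with [t -> - t] and i2
    with [t -> s - t], where [s] is a time at which the flow reaches the image of the starting point
    under i2. Their composite is translation by [s], and [tau] is [s] reduced modulo the period. *)
Lemma lyness_conjugacy (a b p1 p2 h x0 y0 : R) :
  positive_fixed_point a b p1 p2 -> V b a (p1, p2) < h ->
  oval b a h (x0, y0) -> p1 < x0 -> x0 ^ 2 = a + y0 ->
  exists (X Y Phi : R -> R) (T tau : R), 0 < tau < T /\ trajectory a b h X Y /\
    (forall q, oval b a h q -> exists t, (X t, Y t) = q) /\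
    (forall s t, (X s, Y s) = (X t, Y t) <-> exists k : Z, s = t + IZR k * T) /\
    (forall t, continuous Phi t /\ Phi (t + T) = Phi t + 2 * PI) /\
    (forall t, exists r, 0 < r /\
      X t = p1 * exp (r * cos (Phi t)) /\ Y t = p2 * exp (r * sin (Phi t))) /\
    X 0 = x0 /\ Y 0 = y0 /\
    (forall t, X (- t) = (a + Y t) / X t /\ Y (- t) = Y t) /\
    (forall t, (X (t + tau), Y (t + tau)) = lyness2 b a (X t, Y t)).
Proof.
  intros Hp Hh Ho Hx0 Ey0. assert (Hp' := Hp); destruct Hp' as [Ha [Hb [H1 [H2 _]]]].
  destruct (lyness_flow a b p1 p2 h Hp Hh) as
    [X1 [Y1 [Phi1 [T [HT [Ht [Hsurj [Hinj [HPhi Hpol]]]]]]]]].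
  destruct (Hsurj _ Ho) as [t0 Ht0].
  set (X := fun t => X1 (t + t0)); set (Y := fun t => Y1 (t + t0)).
  assert (HXY : trajectory a b h X Y) by (apply (trajectory_shift a b h t0 X1 Y1), Ht).
  assert (X0 : X 0 = x0) by (unfold X; rewrite Rplus_0_l; congruence).
  assert (Y0 : Y 0 = y0) by (unfold Y; rewrite Rplus_0_l; congruence).
  assert (Hsurj' : forall q, oval b a h q -> exists t, (X t, Y t) = q).
  { intros q Hq; destruct (Hsurj q Hq) as [t E]; exists (t - t0).
    unfold X, Y; replace (t - t0 + t0) with t by ring; exact E. }
  assert (Hinj' : forall s t, (X s, Y s) = (X t, Y t) <-> exists k : Z, s = t + IZR k * T).
  { intros s t; unfold X, Y; rewrite Hinj; split; intros [k Hk]; exists k; lra. }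
  assert (Hpos : forall t, 0 < X t /\ 0 < Y t) by (intros t; apply (HXY t)).
  assert (Hi : forall t, X (- t) = (a + Y t) / X t /\ Y (- t) = Y t).
  { assert (Hu := trajectory_unique a b h _ _ _ _ Ha Hb HXY (trajectory_iota_x a b h X Y Ha HXY)).
    intros t; destruct (Hu ltac:(cbv beta; rewrite Ropp_0, X0, Y0, <- Ey0; field; lra)
      ltac:(cbv beta; rewrite Ropp_0; auto) (- t)) as [E1 E2].
    rewrite Ropp_involutive in E1, E2; auto. }
  assert (HXY2 := trajectory_iota_y a b h X Y Hb HXY).
  destruct (Hsurj' _ (proj1 (HXY2 0))) as [s Hs].
  rewrite Ropp_0 in Hs; injection Hs as HsX HsY.
  assert (Hj : forall t, X (t + s) = X (- t) /\ Y (t + s) = (b + X (- t)) / Y (- t)).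
  { apply (trajectory_unique a b h (fun t => X (t + s)) (fun t => Y (t + s)) _ _ Ha Hb
      (trajectory_shift a b h s X Y HXY) HXY2); cbv beta; rewrite Rplus_0_l, Ropp_0; auto. }
  assert (HF : forall t, (X (t + s), Y (t + s)) = lyness2 b a (X t, Y t)).
  { intros t; destruct (Hj t) as [-> ->]; destruct (Hi t) as [-> ->]. reflexivity. }
  set (k := Int_part (s / T)). set (tau := s - IZR k * T).
  assert (HF' : forall t, (X (t + tau), Y (t + tau)) = lyness2 b a (X t, Y t)).
  { intros t; rewrite <- HF; apply Hinj'; exists (- k)%Z; rewrite opp_IZR; unfold tau; ring. }
  assert (Htau : 0 <= tau < T).
  { destruct (base_Int_part (s / T)) as [K1 K2]; fold k in K1, K2.
    assert (Es : s = s / T * T) by (field; lra). unfold tau; split; nra. }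
  exists X, Y, (fun t => Phi1 (t + t0)), T, tau.
  split; [| split; [exact HXY | split; [exact Hsurj' | split; [exact Hinj' | split;
    [| split; [intros t; apply Hpol | auto]]]]]].
  - split; [| lra].
    (* If [tau] were 0, the map would fix the starting point, so [y0 ^ 2 = b + x0], against the
       strict inequality on the parabola. *)
    destruct (proj1 Htau) as [|Hz]; auto; exfalso.
    specialize (HF' 0); rewrite <- Hz, Rplus_0_r, X0, Y0 in HF'.
    unfold lyness2, lyness in HF'; simpl in HF'; injection HF' as E1 E2.
    destruct (right_of_fixed_point a b p1 p2 x0 y0 Hp Hx0 Ey0) as [Hy Hlt].
    rewrite <- E1 in E2.
    assert (y0 * y0 = b + x0) by (rewrite E2 at 1; field; lra). nra.
  - intros t; split.
    + apply (continuous_comp (fun t => t + t0) Phi1); [| apply HPhi].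
      apply (is_derive_continuous _ _ 1); auto_derive; auto.
    + replace (t + T + t0) with (t + t0 + T) by ring; apply HPhi.
Qed.

(** * Angles around the fixed point and orientation of the ovals *)

Lemma continuous_pair (f g : R -> R) (t : R) :
  continuous f t -> continuous g t -> continuous (fun t => (f t, g t)) t.
Proof.
  intros Hf Hg P [eps HP]; unfold filtermap.
  apply (filter_imp (fun s => ball (f t) eps (f s) /\ ball (g t) eps (g s))).
  - intros s Hs; apply HP; exact Hs.
  - apply filter_and; [apply (Hf (ball (f t) eps)) | apply (Hg (ball (g t) eps))];
      exists eps; auto.
Qed.

(** A vector with positive component along the direction [phi] deviates from it by the arctangent of
    cross product over dot product, which depends continuously on the data. *)
Lemma polar_of_rotated (phi z w : R) :
  0 < z * cos phi + w * sin phi ->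
  exists d, 0 < d /\
    z = d * cos (phi + atan ((w * cos phi - z * sin phi) / (z * cos phi + w * sin phi))) /\
    w = d * sin (phi + atan ((w * cos phi - z * sin phi) / (z * cos phi + w * sin phi))).
Proof.
  intros Hd; set (dot := z * cos phi + w * sin phi) in *.
  set (cr := w * cos phi - z * sin phi). set (del := atan (cr / dot)).
  assert (Hc : 0 < cos del).
  { destruct (atan_bound (cr / dot)); apply cos_gt_0; unfold del; lra. }
  assert (Hs : sin del = cr / dot * cos del).
  { rewrite <- (tan_atan (cr / dot)); fold del; unfold tan; field; lra. }
  exists (dot / cos del); split; [apply Rdiv_lt_0_compat; auto |].
  assert (H1 := sin2_cos2 phi); unfold Rsqr in H1.
  rewrite cos_plus, sin_plus, Hs; split.
  - replace (dot / cos del * _) with (dot * cos phi - cr * sin phi) by (field; lra).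
    unfold dot, cr; replace z with (z * 1) at 1 by ring; rewrite <- H1; ring.
  - replace (dot / cos del * _) with (dot * sin phi + cr * cos phi) by (field; lra).
    unfold dot, cr; replace w with (w * 1) at 1 by ring; rewrite <- H1; ring.
Qed.

(** [exp s - 1] has the sign of [s], so the displacements from the fixed point in the plane and in
    logarithmic coordinates make an acute angle. *)
Lemma exp_polar_aligned (p1 p2 r phi : R) : 0 < p1 -> 0 < p2 -> 0 < r ->
  0 < (p1 * exp (r * cos phi) - p1) * cos phi + (p2 * exp (r * sin phi) - p2) * sin phi.
Proof.
  intros H1 H2 Hr.
  assert (Hc := mult_expm1_nonneg (r * cos phi)). assert (Hs := mult_expm1_nonneg (r * sin phi)).
  apply Rmult_lt_reg_l with r; auto; rewrite Rmult_0_r.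
  replace (r * _) with (p1 * (r * cos phi * (exp (r * cos phi) - 1)) +
    p2 * (r * sin phi * (exp (r * sin phi) - 1))) by ring.
  destruct (Req_dec (cos phi) 0) as [E|E].
  - assert (Hn : r * sin phi <> 0).
    { intros H; apply Rmult_integral in H as [H|H]; [lra |].
      generalize (sin2_cos2 phi); rewrite H, E; unfold Rsqr; lra. }
    apply mult_expm1_pos in Hn; nra.
  - assert (Hn : r * cos phi <> 0) by (apply Rmult_integral_contrapositive; split; lra).
    apply mult_expm1_pos in Hn; nra.
Qed.

(** The angle in the plane is [Phi] plus a correction smaller than a quarter turn. The correction is
    periodic, so both angles gain [2 * PI] per period. *)
Lemma oval_counterclockwise (p1 p2 T : R) (X Y Phi : R -> R) :
  0 < p1 -> 0 < p2 -> 0 < T ->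
  (forall t, continuous X t) -> (forall t, continuous Y t) ->
  (forall t, X (t + T) = X t /\ Y (t + T) = Y t) ->
  (forall t, continuous Phi t /\ Phi (t + T) = Phi t + 2 * PI) ->
  (forall t, exists r, 0 < r /\
      X t = p1 * exp (r * cos (Phi t)) /\ Y t = p2 * exp (r * sin (Phi t))) ->
  counterclockwise (p1, p2) (fun t => (X (t * T), Y (t * T))).
Proof.
  intros H1 H2 HT HX HY Hper HPhi Hpol.
  set (dot := fun t => (X t - p1) * cos (Phi t) + (Y t - p2) * sin (Phi t)).
  set (cr := fun t => (Y t - p2) * cos (Phi t) - (X t - p1) * sin (Phi t)).
  assert (Hdot : forall t, 0 < dot t).
  { intros t; destruct (Hpol t) as [r [Hr [EX EY]]]; unfold dot; rewrite EX, EY.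
    apply exp_polar_aligned; auto. }
  set (th := fun t => Phi t + atan (cr t / dot t)).
  assert (cX : forall t, continuous (fun t => X t - p1) t).
  { intros t; apply (continuous_minus X (fun _ => p1)); auto; apply continuous_const. }
  assert (cY : forall t, continuous (fun t => Y t - p2) t).
  { intros t; apply (continuous_minus Y (fun _ => p2)); auto; apply continuous_const. }
  assert (cC : forall t, continuous (fun t => cos (Phi t)) t).
  { intros t; apply (continuous_comp Phi cos); [apply HPhi | apply continuous_cos]. }
  assert (cS : forall t, continuous (fun t => sin (Phi t)) t).
  { intros t; apply (continuous_comp Phi sin); [apply HPhi | apply continuous_sin]. }
  assert (cth : forall t, continuous th t).
  { intros t; apply (continuous_plus Phi (fun t => atan (cr t / dot t))); [apply HPhi |].
    apply (continuous_comp (fun t => cr t / dot t) atan).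
    - apply (continuous_mult (K := R_AbsRing) cr (fun t => / dot t)).
      + apply (continuous_minus (fun t => (Y t - p2) * cos (Phi t)) (fun t => (X t - p1) * sin (Phi t)));
          apply (continuous_mult (K := R_AbsRing)); auto.
      + apply (continuous_comp dot Rinv); [| apply continuous_Rinv, Rgt_not_eq, Hdot].
        apply (continuous_plus (fun t => (X t - p1) * cos (Phi t)) (fun t => (Y t - p2) * sin (Phi t)));
          apply (continuous_mult (K := R_AbsRing)); auto.
    - eapply is_derive_continuous; auto_derive; auto. }
  assert (hp := PI_RGT_0).
  exists (fun t => th (t * T) / (2 * PI)); split; [| split].
  - intros t; apply (continuous_mult (K := R_AbsRing) (fun t => th (t * T)) (fun _ => / (2 * PI)));
      [| apply continuous_const].
    apply (continuous_comp (fun t => t * T) th); auto.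
    eapply is_derive_continuous; auto_derive; auto.
  - intros t; replace ((t + 1) * T) with (t * T + T) by ring.
    unfold th, cr, dot; destruct (Hper (t * T)) as [-> ->]; destruct (HPhi (t * T)) as [_ ->].
    rewrite cos_plus, sin_plus, cos_2PI, sin_2PI, !Rmult_1_r, !Rmult_0_r, Rminus_0_r, Rplus_0_r.
    field; lra.
  - intros t; destruct (polar_of_rotated (Phi (t * T)) _ _ (Hdot (t * T))) as [d [Hd [E1 E2]]].
    exists d; split; auto; simpl.
    replace (2 * PI * (th (t * T) / (2 * PI))) with (th (t * T)) by (field; lra).
    unfold th, cr, dot; rewrite <- E1, <- E2; f_equal; ring.
Qed.

(** * Comparison of the rotation number with 5/8 *)

(** The derivative makes [f] negative just after 0, and the intermediate value theorem forbids a
    change of sign without a zero. *)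
Lemma negative_before_first_zero (f : R -> R) (l m : R) :
  (forall t, continuous f t) -> is_derive f 0 l -> l < 0 -> f 0 = 0 ->
  (forall t, 0 < t < m -> f t <> 0) -> forall t, 0 < t < m -> f t < 0.
Proof.
  intros Hc Hd Hl H0 Hnz t Ht.
  apply is_derive_Reals in Hd.
  destruct (Hd (- l) ltac:(lra)) as [delta Hdelta].
  assert (dp := cond_pos delta).
  set (s := Rmin t (delta / 2)).
  assert (Hs : 0 < s) by (apply Rmin_pos; lra).
  assert (Hst : s <= t) by apply Rmin_l.
  assert (Hsd : s <= delta / 2) by apply Rmin_r.
  specialize (Hdelta s ltac:(lra) ltac:(rewrite Rabs_pos_eq; lra)).
  rewrite Rplus_0_l, H0, Rminus_0_r in Hdelta.
  apply Rabs_def2 in Hdelta.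
  assert (Hfs : f s < 0).
  { replace (f s) with (f s / s * s) by (field; lra). nra. }
  destruct (Rlt_or_le (f t) 0) as [|Hft]; auto; exfalso.
  destruct (IVT_gen f s t 0) as [z [Hz Hfz]].
  - intros x; apply continuity_pt_filterlim, Hc.
  - rewrite Rmin_left, Rmax_right; lra.
  - rewrite Rmin_left, Rmax_right in Hz by lra. apply (Hnz z); lra.
Qed.

(** Here [(x, y)] is the starting point on the parabola and [(x, w)] its first image. The parameters
    [a], [b] and the shifted level [k] are polynomials in [x], [y], [w], so both conclusions are
    rational identities in three free variables. *)
Lemma fourth_iterate_identities (x y w a b d k x2 y2 x3 y3 x4 y4 n A : R) :
  x <> 0 -> y <> 0 -> w <> 0 -> x2 <> 0 -> y2 <> 0 -> x3 <> 0 -> y3 <> 0 ->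
  a = x ^ 2 - y -> b = w * y - x -> d = w - y -> k = y * (2 * x ^ 2 * w + d * w - x) ->
  n = a * b -> A = (a ^ 2 - b) * (b ^ 2 - a) ->
  x2 = (a + w) / x -> y2 = (b + x2) / w -> x3 = (a + y2) / x2 -> y3 = (b + x3) / y2 ->
  x4 = (a + y3) / x3 -> y4 = (b + x4) / y3 ->
  x2 ^ 2 - a - y2 = d * k / (x ^ 2 * w * y) /\
  x4 ^ 2 - a - y4 =
    - (d * k * (- n * k ^ 3 + (A + (2 * n - 1) * (n - 1)) * k ^ 2 - A * (4 * n - 3) * k + 2 * A ^ 2))
    / (x ^ 5 * y ^ 2 * w ^ 4 * x2 ^ 3 * y2 ^ 3 * x3 ^ 2 * y3).
Proof.
  intros Hx Hy Hw Hx2 Hy2 Hx3 Hy3 -> -> -> -> -> -> E2 F2 E3 F3 E4 F4.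
  (* Each iterate is simplified with its numerator isolated: a nonzero iterate has a nonzero
     numerator, which reappears in the denominator of a later one. *)
  assert (N2 : x2 = (x ^ 2 + (w - y)) / x) by (rewrite E2; field; auto).
  assert (M2 : y2 = (x * y * w + (w - y)) / (x * w)) by (rewrite F2, N2; field; auto).
  split; [rewrite M2, N2; field; auto |].
  assert (P2 : x ^ 2 + (w - y) <> 0) by (intros H; apply Hx2; rewrite N2, H; field; auto).
  assert (Q2 : x * y * w + (w - y) <> 0) by (intros H; apply Hy2; rewrite M2, H; field; auto).
  assert (N3 : x3 = (x ^ 3 * w + (w - y)) / (w * (x ^ 2 + (w - y))))
    by (rewrite E3, M2, N2; field; auto).
  assert (P3 : x ^ 3 * w + (w - y) <> 0) by (intros H; apply Hx3; rewrite N3, H; field; auto).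
  set (m3 := w ^ 2 * y * (x ^ 2 + (w - y)) - x * w * (w - y) + (w - y)).
  assert (M3 : y3 = x * m3 / ((x ^ 2 + (w - y)) * (x * y * w + (w - y))))
    by (rewrite F3, N3, M2; unfold m3; field; auto).
  assert (Q3 : m3 <> 0) by (intros H; apply Hy3; rewrite M3, H; field; auto).
  rewrite F4, E4, M3, N3, M2, N2; unfold m3 in *; field; repeat split; auto.
Qed.

(* In the variable [k = h + 2 * a * b + 1], the factor of the condition
   [F ^ 8 = id] on [V = h] that comes from primitive period 8. *)
Definition resonance8 (a b k : R) : R :=
  - (a * b) * k ^ 3
  + ((a ^ 2 - b) * (b ^ 2 - a) + (2 * (a * b) - 1) * (a * b - 1)) * k ^ 2
  - (a ^ 2 - b) * (b ^ 2 - a) * (4 * (a * b) - 3) * k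
  + 2 * ((a ^ 2 - b) * (b ^ 2 - a)) ^ 2.

Definition side (a : R) (q : R * R) : R := fst q ^ 2 - a - snd q.

Ltac mult_pos := repeat first [assumption | apply pow_lt | apply Rmult_lt_0_compat].

(** The starting point is fixed by i1, so its first image is [(x, w)], and [x + b < y ^ 2] gives
    [w < y]. The later signs follow from the factor [w - y] in the rational identities and from the
    positivity of [h + 2 * (a * b) + 1]. *)
Lemma iterate_sides (a b h x y : R) :
  0 < a -> 0 < b -> 0 < h -> 0 < x -> 0 < y -> x ^ 2 = a + y -> x + b < y ^ 2 ->
  V b a (x, y) = h ->
  let F := lyness2 b a in let q := (x, y) in
  0 < side a (F q) /\ side a (F (F q)) < 0 /\
  exists c, 0 < c /\ side a (F (F (F (F q)))) = c * resonance8 a b (h + 2 * (a * b) + 1).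
Proof.
  intros Ha Hb Hh Hx Hy Exy Hlt HV F q0.
  set (w := (b + x) / y). set (x2 := (a + w) / x). set (y2 := (b + x2) / w).
  set (x3 := (a + y2) / x2). set (y3 := (b + x3) / y2).
  set (x4 := (a + y3) / x3). set (y4 := (b + x4) / y3).
  assert (Ew : (a + y) / x = x) by (rewrite <- Exy; field; lra).
  assert (F1 : F q0 = (x, w)) by (unfold F, lyness2, lyness, q0; simpl; rewrite Ew; reflexivity).
  assert (F2 : F (F q0) = (x2, y2)) by (rewrite F1; reflexivity).
  assert (F3 : F (F (F q0)) = (x3, y3)) by (rewrite F2; reflexivity).
  assert (F4 : F (F (F (F q0))) = (x4, y4)) by (rewrite F3; reflexivity).
  assert (pw : 0 < w) by (apply Rdiv_lt_0_compat; lra).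
  assert (px2 : 0 < x2) by (apply Rdiv_lt_0_compat; lra).
  assert (py2 : 0 < y2) by (apply Rdiv_lt_0_compat; lra).
  assert (px3 : 0 < x3) by (apply Rdiv_lt_0_compat; lra).
  assert (py3 : 0 < y3) by (apply Rdiv_lt_0_compat; lra).
  assert (Ea : a = x ^ 2 - y) by lra.
  assert (Eb : b = w * y - x) by (unfold w; field; lra).
  assert (Hd : w - y < 0).
  { apply Rmult_lt_reg_r with y; auto. nra. }
  assert (Ek : h + 2 * (a * b) + 1 = y * (2 * x ^ 2 * w + (w - y) * w - x)).
  { rewrite <- HV; unfold V; rewrite Eb, Ea; field; lra. }
  assert (Hk : 0 < h + 2 * (a * b) + 1) by nra.
  destruct (fourth_iterate_identities x y w a b (w - y) (h + 2 * (a * b) + 1) x2 y2 x3 y3 x4 y4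
    (a * b) ((a ^ 2 - b) * (b ^ 2 - a))) as [I2 I4]; try lra; try reflexivity.
  rewrite F4, F2, F1; unfold side; simpl fst; simpl snd; split; [lra | split].
  - rewrite I2; unfold Rdiv.
    assert (0 < / (x ^ 2 * w * y)) by (apply Rinv_0_lt_compat; mult_pos).
    set (i := / _) in *. set (k := h + _ + _) in *.
    assert (0 < k * i) by (apply Rmult_lt_0_compat; auto). nra.
  - exists (- (w - y) * (h + 2 * (a * b) + 1) / (x ^ 5 * y ^ 2 * w ^ 4 * x2 ^ 3 * y2 ^ 3 * x3 ^ 2 * y3)).
    split.
    + apply Rdiv_lt_0_compat; mult_pos; lra.
    + rewrite I4; unfold resonance8; field; repeat split; lra.
Qed.

Lemma rotation_number_five_eighths (a b p1 p2 h : R) :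
  positive_fixed_point a b p1 p2 -> V b a (p1, p2) < h ->
  exists r, is_rotation_number (lyness2 b a) (oval b a h) (p1, p2) r /\
    (resonance8 a b (h + 2 * (a * b) + 1) < 0 -> r < 5 / 8) /\
    (resonance8 a b (h + 2 * (a * b) + 1) = 0 -> r = 5 / 8).
Proof.
  intros Hp Hh. assert (Hp' := Hp); destruct Hp' as [Ha [Hb [H1 [H2 [E1 E2]]]]].
  assert (Vpos : 0 < V b a (p1, p2)).
  { unfold V; apply Rdiv_lt_0_compat; [| nra].
    repeat apply Rplus_lt_0_compat; repeat apply Rmult_lt_0_compat; try apply pow_lt; try lra; nra. }
  assert (Hx0 : exists x0, p1 < x0 /\ V b a (x0, x0 ^ 2 - a) = h).
  (* The point is sought along the parabola, outwards from the fixed point; [Rmax p1] freezes the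
     function to the left of [p1], making it continuous on the whole line. *)
  { set (f := fun x => V b a (Rmax p1 x, (Rmax p1 x) ^ 2 - a)).
    assert (Hm : forall x, 0 < Rmax p1 x /\ 0 < (Rmax p1 x) ^ 2 - a).
    { intros x; assert (p1 <= Rmax p1 x) by apply Rmax_l; split; nra. }
    set (x1 := Rmax p1 (h / a + 1)).
    assert (Hx1 : p1 <= x1) by apply Rmax_l.
    assert (Hf1 : h < f x1).
    { unfold f; rewrite Rmax_right by auto.
      assert (Hy1 : 0 < x1 ^ 2 - a) by nra. set (y1 := x1 ^ 2 - a) in *.
      assert (a * x1 < V b a (x1, y1)).
      { assert (0 < (b * x1 * y1 ^ 2 + b * x1 ^ 2 + a * y1 ^ 2 + (b ^ 2 + a) * x1 +
          (b + a ^ 2) * y1 + a * b) / (x1 * y1)).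
        { apply Rdiv_lt_0_compat; [| nra].
          repeat apply Rplus_lt_0_compat; mult_pos; nra. }
        replace (V b a (x1, y1)) with (a * x1 + (b * x1 * y1 ^ 2 + b * x1 ^ 2 + a * y1 ^ 2 +
          (b ^ 2 + a) * x1 + (b + a ^ 2) * y1 + a * b) / (x1 * y1)) by (unfold V; field; lra).
        lra. }
      assert (h / a + 1 <= x1) by apply Rmax_r.
      assert (h < a * x1) by (replace h with (a * (h / a)) by (field; lra); nra). lra. }
    assert (Hf0 : f p1 < h).
    { unfold f; rewrite Rmax_left by lra; replace (p1 ^ 2 - a) with p2 by lra; auto. }
    destruct (IVT_gen f p1 x1 h) as [z [Hz Hfz]].
    - intros x; apply continuity_pt_filterlim.
      apply (continuous_comp (Rmax p1) (fun x => V b a (x, x ^ 2 - a))).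
      + intros P [eps HP]; exists eps; intros y Hy; apply HP.
        unfold ball in *; simpl in *; unfold AbsRing_ball, abs, minus, plus, opp in *; simpl in *.
        apply Rle_lt_trans with (2 := Hy).
        unfold Rmax, Rabs; repeat destruct Rle_dec; repeat destruct Rcase_abs; lra.
      + destruct (Hm x). unfold V; eapply is_derive_continuous; auto_derive; [| reflexivity].
        apply Rgt_not_eq. set (m := Rmax p1 x) in *. nra.
    - rewrite Rmin_left, Rmax_right; lra.
    - rewrite Rmin_left, Rmax_right in Hz by lra.
      unfold f in Hfz; rewrite Rmax_right in Hfz by lra.
      exists z; split; auto. destruct Hz as [[|Hz] _]; auto.
      exfalso; subst; unfold f in Hf0; rewrite Rmax_left in Hf0 by lra; lra. }
  destruct Hx0 as [x0 [Hx0 HV]]. set (y0 := x0 ^ 2 - a) in HV.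
  assert (Ey : x0 ^ 2 = a + y0) by (unfold y0; ring).
  destruct (right_of_fixed_point a b p1 p2 x0 y0 Hp Hx0 Ey) as [Hy0 Hlt].
  assert (Ho : oval b a h (x0, y0)) by (repeat split; simpl; auto; lra).
  destruct (lyness_conjugacy a b p1 p2 h x0 y0 Hp Hh Ho Hx0 Ey) as
    [X [Y [Phi [T [tau [Htau [HXY [Hsurj [Hinj [HPhi [Hpol [X0 [Y0 [Hi HF]]]]]]]]]]]]]].
  assert (HT : 0 < T) by lra.
  assert (cX : forall t, continuous X t) by (intros t; eapply is_derive_continuous; apply (HXY t)).
  assert (cY : forall t, continuous Y t) by (intros t; eapply is_derive_continuous; apply (HXY t)).
  assert (Hper : forall (k : Z) t, X (t + IZR k * T) = X t /\ Y (t + IZR k * T) = Y t).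
  { intros k t.
    assert (E : (X (t + IZR k * T), Y (t + IZR k * T)) = (X t, Y t)) by (apply Hinj; exists k; ring).
    injection E; auto. }
  exists (tau / T); split.
  { split.
    { split; [apply Rdiv_lt_0_compat; lra |].
      apply Rmult_lt_reg_r with T; auto. unfold Rdiv; rewrite Rmult_assoc, Rinv_l; lra. }
    exists (fun t => (X (t * T), Y (t * T))); split; [| split].
    - split; [| split].
      + intros t; apply (continuous_comp (fun t => t * T) (fun t => (X t, Y t))).
        * eapply is_derive_continuous; auto_derive; auto.
        * apply continuous_pair; auto.
      + intros s t; rewrite Hinj; split; intros [k Hk]; exists k.
        * apply Rmult_eq_reg_r with T; lra.
        * rewrite Hk; ring.
      + intros q; split.
        * intros Hq; destruct (Hsurj q Hq) as [t Et]; exists (t / T).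
          replace (t / T * T) with t by (field; lra); exact Et.
        * intros [t <-]; apply (HXY (t * T)).
    - apply (oval_counterclockwise p1 p2 T X Y Phi); auto.
      intros t; rewrite <- (Rmult_1_l T); apply (Hper 1%Z).
    - intros t; rewrite <- HF; do 2 f_equal; field; lra. }
  set (f := fun t => side a (X t, Y t)).
  assert (fper : forall k t, f (t + IZR k * T) = f t).
  { intros k t; unfold f; destruct (Hper k t) as [-> ->]; reflexivity. }
  (* A zero of [f] is a point fixed by i1, so [t] and [- t] differ by a multiple of the period. *)
  assert (fzero : forall t, f t = 0 -> exists k : Z, 2 * t = IZR k * T).
  { intros t Hf. unfold f, side in Hf; simpl fst in Hf; simpl snd in Hf.
    destruct (proj1 (proj1 (HXY t))) as [px _]; simpl in px.
    destruct (Hi t) as [E3 E4].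
    assert (E : (X t, Y t) = (X (- t), Y (- t))).
    { rewrite E3, E4; f_equal; replace (a + Y t) with (X t ^ 2) by lra; field; lra. }
    apply Hinj in E as [k Hk]; exists k; lra. }
  (* At time 0 the second coordinate is stationary because [x0 ^ 2 = a + y0], so the derivative of
     [f] comes from [X] alone, which is decreasing there. *)
  assert (fneg : forall t, 0 < t < T / 2 -> f t < 0).
  { apply (negative_before_first_zero f (2 * x0 * field_x a b x0 y0)).
    - intros t; unfold f, side; simpl.
      apply (continuous_minus (fun t => X t * (X t * 1) - a) Y); auto.
      apply (continuous_minus (fun t => X t * (X t * 1)) (fun _ => a)); [| apply continuous_const].
      repeat apply (continuous_mult (K := R_AbsRing)); auto; apply continuous_const.
    - destruct (HXY 0) as [_ [dX dY]]; rewrite X0, Y0 in dX, dY.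
      unfold f, side; simpl.
      auto_derive; [repeat split; eexists; eassumption |].
      replace (Derive (fun x => X x) 0) with (field_x a b x0 y0) by (symmetry; apply is_derive_unique, dX).
      replace (Derive (fun x => Y x) 0) with (field_y a b x0 y0) by (symmetry; apply is_derive_unique, dY).
      rewrite X0. unfold field_y. replace (y0 + a) with (x0 ^ 2) by lra. field; lra.
    - unfold field_x.
      assert (0 < y0 - (x0 + b) / y0).
      { apply Rmult_lt_reg_r with y0; [lra |]. field_simplify; lra. }
      assert (0 < b * x0 + a) by nra.
      assert (0 < (b * x0 + a) * (y0 - (x0 + b) / y0)) by (apply Rmult_lt_0_compat; auto).
      nra.
    - unfold f, side; simpl fst; simpl snd; rewrite X0, Y0; lra.
    - intros t Ht Hf; destruct (fzero t Hf) as [k Hk].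
      assert (0 < IZR k < 1) as [K1 K2] by (split; nra).
      apply lt_IZR in K1; apply lt_IZR in K2; lia. }
  (* The involution i1, which is [t -> - t], exchanges the two sides of the parabola. *)
  assert (fsym : forall t, f t < 0 -> 0 < f (T - t)).
  { intros t Hf; replace (T - t) with (- t + IZR 1 * T) by ring; rewrite fper.
    unfold f, side in *; simpl fst in *; simpl snd in *.
    destruct (proj1 (proj1 (HXY t))) as [px py]; simpl in px, py.
    destruct (Hi t) as [-> ->].
    replace (((a + Y t) / X t) ^ 2 - a - Y t) with ((a + Y t) / X t ^ 2 * - (X t ^ 2 - a - Y t)) by (field; lra).
    apply Rmult_lt_0_compat; [apply Rdiv_lt_0_compat; nra | lra]. }
  assert (fhalf : f (T / 2) = 0).
  { assert (E : f (- (T / 2)) = f (T / 2)).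
    { rewrite <- (fper 1%Z); f_equal; field. }
    unfold f, side in *; simpl fst in *; simpl snd in *.
    destruct (proj1 (proj1 (HXY (T / 2)))) as [px py]; simpl in px, py.
    destruct (Hi (T / 2)) as [E3 E4]; rewrite E3, E4 in E.
    set (x := X (T / 2)) in *; set (y := Y (T / 2)) in *.
    assert (E5 : (x ^ 2 - (a + y)) * ((a + y) / x ^ 2 + 1) = 0).
    { transitivity ((x ^ 2 - a - y) - (((a + y) / x) ^ 2 - a - y)); [field; lra | lra]. }
    apply Rmult_integral in E5 as [E5|E5]; [lra |].
    assert (0 < (a + y) / x ^ 2) by (apply Rdiv_lt_0_compat; nra). lra. }
  assert (flt : forall t, 0 < t < T -> f t < 0 -> t < T / 2).
  { intros t Ht Hf; destruct (Rlt_or_le t (T / 2)) as [|[Hl|He]]; auto; exfalso.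
    - assert (H := fsym (T - t) (fneg (T - t) ltac:(lra))).
      replace (T - (T - t)) with t in H by ring; lra.
    - rewrite <- He, fhalf in Hf; lra. }
  assert (Hh0 : 0 < h) by lra.
  destruct (iterate_sides a b h x0 y0 Ha Hb Hh0 ltac:(lra) ltac:(lra) Ey Hlt HV)
    as [S1 [S2 [c [Hc S4]]]].
  assert (Q0 : (X 0, Y 0) = (x0, y0)) by (rewrite X0, Y0; auto).
  rewrite <- Q0 in S1, S2, S4.
  rewrite <- HF in S1; rewrite <- HF, <- HF in S2; rewrite <- HF, <- HF, <- HF, <- HF in S4.
  fold (f (0 + tau)) in S1. fold (f (0 + tau + tau)) in S2.
  fold (f (0 + tau + tau + tau + tau)) in S4.
  (* The first image is on the positive side, hence in the second half of the period. *)
  assert (R1 : T / 2 < tau).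
  { destruct (Rlt_or_le (T / 2) tau) as [|[Hl|He]]; auto; exfalso.
    - assert (H := fneg tau ltac:(lra)); rewrite Rplus_0_l in S1; lra.
    - rewrite Rplus_0_l, He, fhalf in S1; lra. }
  (* The second image, at time [2 * tau - T] modulo [T], is on the negative side, hence in the first
     half. *)
  assert (R2 : tau < 3 / 4 * T).
  { enough (2 * tau - T < T / 2) by lra. apply flt; [lra |].
    replace (2 * tau - T) with (0 + tau + tau + IZR (-1) * T) by ring; rewrite fper; auto. }
  (* The bounds on [tau] put [4 * tau - 2 * T] strictly between 0 and [T], so the side of the fourth
     image compares this time with [T / 2]. *)
  replace (0 + tau + tau + tau + tau) with (4 * tau - 2 * T + IZR 2 * T) in S4 by ring.
  rewrite fper in S4.
  assert (Hdiv : forall z, tau = z * T -> tau / T = z) by (intros z ->; field; lra).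
  split; intros HG.
  - assert (f (4 * tau - 2 * T) < 0) by (rewrite S4; nra).
    assert (4 * tau - 2 * T < T / 2) by (apply flt; auto; lra).
    apply Rmult_lt_reg_r with T; auto. unfold Rdiv; rewrite Rmult_assoc, Rinv_l; lra.
  - rewrite HG, Rmult_0_r in S4.
    (* The only zero of [f] strictly inside the period is [T / 2], and [4 * tau - 2 * T = T / 2]
       means [tau = 5 / 8 * T]. *)
    apply Hdiv. destruct (fzero _ S4) as [k Hk].
    assert (0 < IZR k < 2) as [K1 K2] by (split; nra).
    apply lt_IZR in K1; apply lt_IZR in K2. replace k with 1%Z in Hk by lia. lra.
Qed.

(* For [a * b] and [a ^ 3 + b ^ 3] as below the cubic [resonance8 a b] has the
   double root [21 / 4]; its double-root locus is a rational curve in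
   [(a * b, a ^ 3 + b ^ 3)], and this is a point of small height on it. *)
Lemma tangent_parameters : exists a b, 51 / 1000 <= a <= 52 / 1000 /\
  78 / 100 <= b <= 79 / 100 /\ a * b = 5 / 124 /\ a ^ 3 + b ^ 3 = 14961 / 30752.
Proof.
  (* Substituting [a = 5 / 124 / b] in the equation for the sum of cubes and multiplying by [b ^ 3]
     gives this sextic. *)
  destruct (IVT_gen (fun b => b ^ 6 - 14961 / 30752 * b ^ 3 + (5 / 124) ^ 3)
    (78 / 100) (79 / 100) 0) as [b [Hb Eb]].
  - reg.
  - rewrite Rmin_left, Rmax_right; lra.
  - rewrite Rmin_left, Rmax_right in Hb by lra.
    exists (5 / 124 / b), b.
    assert (E : 5 / 124 / b * b = 5 / 124) by (field; lra).
    repeat split; try lra; try nra.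
    apply Rmult_eq_reg_r with (b ^ 3); [| apply Rgt_not_eq, pow_lt; lra].
    replace ((_ + _) * b ^ 3) with ((5 / 124 / b * b) ^ 3 + b ^ 6) by ring.
    rewrite E; lra.
Qed.

(** The product [(a ^ 2 - b) * (b ^ 2 - a)] depends only on [a * b] and [a ^ 3 + b ^ 3], which is
    why the parameters are prescribed through these. The simple root is below 1, whereas
    [h + 2 * (a * b) + 1] exceeds 1 for [h > 0]. *)
Lemma resonance8_double_root (a b k : R) :
  a * b = 5 / 124 -> a ^ 3 + b ^ 3 = 14961 / 30752 ->
  resonance8 a b k = - (5 / 124) * (k - 21 / 4) ^ 2 * (k - 441 / 1240).
Proof.
  intros En ES; unfold resonance8.
  replace ((a ^ 2 - b) * (b ^ 2 - a)) with ((a * b) ^ 2 + a * b - (a ^ 3 + b ^ 3)) by ring.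
  rewrite En, ES; field.
Qed.

(** The double root corresponds to [h = 21 / 4 - 2 * (5 / 124) - 1], about 4.17; the bound 4.1
    ensures that this level is an oval. *)
Lemma fixed_point_below (a b : R) :
  51 / 1000 <= a <= 52 / 1000 -> 78 / 100 <= b <= 79 / 100 ->
  exists p1 p2, positive_fixed_point a b p1 p2 /\ V b a (p1, p2) < 21 / 5 - 1 / 10.
Proof.
  intros Ha Hb.
  (* Eliminating [p2 = p1 ^ 2 - a] from the fixed point equations leaves this quartic in [p1]. *)
  destruct (IVT_gen (fun x => (x ^ 2 - a) ^ 2 - b - x) (6 / 5) (5 / 4) 0) as [x [Hx Ex]].
  - reg.
  - assert ((6 / 5) ^ 2 - a <= 139 / 100) by lra. assert (151 / 100 <= (5 / 4) ^ 2 - a) by lra.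
    rewrite Rmin_left, Rmax_right; nra.
  - rewrite Rmin_left, Rmax_right in Hx by lra.
    set (y := x ^ 2 - a) in Ex.
    assert (Hx2 : 36 / 25 <= x ^ 2 <= 25 / 16) by nra.
    assert (Hy : 138 / 100 <= y <= 152 / 100) by (unfold y; lra).
    exists x, y; split; [repeat split; unfold y in *; lra |].
    assert (Hxy : 165 / 100 <= x * y) by nra.
    unfold V; apply Rmult_lt_reg_r with (x * y); [lra |].
    replace (_ / (x * y) * (x * y)) with (a * x ^ 2 * y + b * x * y ^ 2 + b * x ^ 2 + a * y ^ 2
      + (b ^ 2 + a) * x + (b + a ^ 2) * y + a * b) by (field; lra).
    assert (t1 : a * x ^ 2 * y <= 52 / 1000 * (25 / 16) * (152 / 100))
      by (apply Rmult_le_compat; [nra | lra | apply Rmult_le_compat | lra]; lra).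
    assert (t2 : b * x * y ^ 2 <= 79 / 100 * (5 / 4) * (152 / 100) ^ 2)
      by (apply Rmult_le_compat; [nra | nra | apply Rmult_le_compat | nra]; lra).
    assert (t3 : b * x ^ 2 <= 79 / 100 * (25 / 16)) by (apply Rmult_le_compat; lra).
    assert (t4 : a * y ^ 2 <= 52 / 1000 * (152 / 100) ^ 2) by (apply Rmult_le_compat; nra).
    assert (t5 : (b ^ 2 + a) * x <= ((79 / 100) ^ 2 + 52 / 1000) * (5 / 4)) by (apply Rmult_le_compat; nra).
    assert (t6 : (b + a ^ 2) * y <= (79 / 100 + (52 / 1000) ^ 2) * (152 / 100)) by (apply Rmult_le_compat; nra).
    assert (t7 : a * b <= 52 / 1000 * (79 / 100)) by (apply Rmult_le_compat; lra).
    lra.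
Qed.

Theorem theorem3 :
  exists a b : R, 0 < a /\ 0 < b /\
    exists (p : R * R) (rho : R -> R),
      Qplus p /\ lyness2 b a p = p /\
      (forall h : R, V b a p < h ->
         is_rotation_number (lyness2 b a) (oval b a h) p (rho h)) /\
      (exists h0 : R, V b a p < h0 /\ strict_local_max rho h0).
Proof.
  destruct tangent_parameters as [a [b [Ha [Hb [En ES]]]]].
  destruct (fixed_point_below a b Ha Hb) as [p1 [p2 [Hp HV]]].
  exists a, b; split; [lra | split; [lra |]].
  destruct (functional_choice (fun h r => V b a (p1, p2) < h ->
    is_rotation_number (lyness2 b a) (oval b a h) (p1, p2) r /\
    (resonance8 a b (h + 2 * (a * b) + 1) < 0 -> r < 5 / 8) /\
    (resonance8 a b (h + 2 * (a * b) + 1) = 0 -> r = 5 / 8))) as [rho Hrho].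
  { intros h; destruct (Rlt_or_le (V b a (p1, p2)) h) as [Hh|Hh].
    - destruct (rotation_number_five_eighths a b p1 p2 h Hp Hh) as [r Hr]; exists r; auto.
    (* Outside the range of the ovals the value 0 is a placeholder. *)
    - exists 0; intros; lra. }
  destruct Hp as [_ [_ [H1 [H2 [E1 E2]]]]].
  assert (Vpos : 0 < V b a (p1, p2)).
  { unfold V; apply Rdiv_lt_0_compat; [| nra].
    repeat apply Rplus_lt_0_compat; mult_pos; nra. }
  exists (p1, p2), rho; split; [split; auto | split; [| split]].
  - rewrite lyness2_formula by auto; f_equal.
    + rewrite <- E1; field; lra.
    + replace (a + b * p1 + p2) with (p1 * p2 ^ 2) by (rewrite E2; nra). field; lra.
  - intros h Hh; apply (Hrho h Hh).
  - assert (Hh0 : V b a (p1, p2) < 21 / 4 - 2 * (5 / 124) - 1) by lra.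
    exists (21 / 4 - 2 * (5 / 124) - 1); split; [exact Hh0 |].
    destruct (Hrho _ Hh0) as [_ [_ Hmax]].
    rewrite resonance8_double_root, En in Hmax by auto.
    unfold strict_local_max, locally', within; rewrite Hmax by field.
    (* The neighbourhood reaches down to the level of the fixed point, so every [h] in it has an
       oval. *)
    assert (Hd : 0 < 21 / 4 - 2 * (5 / 124) - 1 - V b a (p1, p2)) by lra.
    exists (mkposreal _ Hd); intros h Hball Hne.
    change (Rabs (h - (21 / 4 - 2 * (5 / 124) - 1)) < 21 / 4 - 2 * (5 / 124) - 1 - V b a (p1, p2)) in Hball.
    apply Rabs_def2 in Hball.
    destruct (Hrho h ltac:(lra)) as [_ [Hlt _]]; apply Hlt.
    rewrite resonance8_double_root, En by auto.
    (* The square is positive because [h] differs from the level of the double root, and the simple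
       factor because [h > 0]. *)
    assert (0 < (h + 2 * (5 / 124) + 1 - 21 / 4) ^ 2) by (apply pow2_gt_0; lra).
    assert (0 < h + 2 * (5 / 124) + 1 - 441 / 1240) by lra.
    set (u := (_ - 21 / 4) ^ 2) in *. nra.
Qed.
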